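(* Let $R$ be a ring, let $\mathcal{X}$ be a class of right $R$-modules closed under isomorphisms, and let $M$ be a right $R$-module with an epimorphic $\mathcal{X}$-cover $p:X\to M$ such that $\mathrm{End}(X)/J(\mathrm{End}(X))$ is a von Neumann regular right self-injective ring and idempotents lift modulo $J(\mathrm{End}(X))$. If $M$ is $\mathcal{X}$-automorphism-coinvariant and every direct summand of $M$ has an $\mathcal{X}$-cover, then $M$ admits a decomposition $M=N\oplus L$ such that: (i) $N$ is a square-free module; (ii) $L$ is $\mathcal{X}$-endomorphism-coinvariant, $\mathrm{End}(L)/J(\mathrm{End}(L))$ is von Neumann regular and right self-injective, and idempotents lift modulo $J(\mathrm{End}(L))$; (iii) both $\mathrm{Hom}_R(N,L)$ and $\mathrm{Hom}_R(L,N)$ are contained in $J(\mathrm{End}(M))$. In particular, $\mathrm{End}(M)/J(\mathrm{End}(M))$ is the direct product of an abelian regular ring and a right self-injective von Neumann regular ring.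
   Context: Rings are associative with identity, modules are unital right modules, $J(-)$ is the Jacobson radical. An $\mathcal{X}$-precover of $M$ is a homomorphism $p:X\to M$ with $X\in\mathcal{X}$ such that every homomorphism $X'\to M$ with $X'\in\mathcal{X}$ factors through $p$. It is an $\mathcal{X}$-cover if, moreover, every endomorphism $h$ of $X$ with $p\circ h=p$ is an automorphism; it is epimorphic if $p$ is an epimorphism. $M$ is $\mathcal{X}$-automorphism-coinvariant (resp. $\mathcal{X}$-endomorphism-coinvariant) if there is an $\mathcal{X}$-cover $p:X\to M$ such that for every automorphism (resp. endomorphism) $g$ of $X$ there is an endomorphism $f$ of $M$ with $f\circ p=p\circ g$. A module $N$ is square-free if there is no decomposition $N=N_1\oplus N_2\oplus N_3$ with $N_1\cong N_2\neq 0$. A ring is abelian regular if it is von Neumann regular and all its idempotents are central. For $M=N\oplus L$ with injections $v_N,v_L$ and projections $\pi_N,\pi_L$, $\mathrm{Hom}_R(N,L)$ is identified with a subset of $\mathrm{End}(M)$ via $f\mapsto v_L\circ f\circ\pi_N$, and $\mathrm{Hom}_R(L,N)$ via $f\mapsto v_N\circ f\circ \pi_L$. *)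

(* Defs.v *)
From HB Require Import structures.
From mathcomp Require Import all_boot all_algebra.
From mathcomp Require Import boolp classical_sets.

Set Implicit Arguments.
Unset Strict Implicit.
Unset Printing Implicit Defensive.

Import GRing.Theory.
Local Open Scope ring_scope.
Local Open Scope quotient_scope.

(* A right R-module is a left module over the converse ring: for r : R^c, the
   element [r *: m] is the product m r. *)
Notation rmodType R := (lmodType R^c).

(* Endomorphisms act on the left, also for right modules: (f * g) x = f (g x). *)

Section EndomorphismRing.
Variables (R : pzRingType) (U : lmodType R).

Definition endo : Type := {linear U -> U}.

HB.instance Definition _ := gen_eqMixin endo.
HB.instance Definition _ := gen_choiceMixin endo.

Definition endo_app (f : endo) : U -> U := (f : {linear U -> U}).
Definition endo_zero : endo := (\0 : {linear U -> U}).
Definition endo_opp (f : endo) : endo := (\- endo_app f : {linear U -> U}).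
Definition endo_add (f g : endo) : endo :=
  (endo_app f \+ endo_app g : {linear U -> U}).
Definition endo_one : endo := (idfun : {linear U -> U}).
Definition endo_mul (f g : endo) : endo :=
  (endo_app f \o endo_app g : {linear U -> U}).

Lemma endoP (f g : endo) : endo_app f =1 endo_app g -> f = g.
Proof.
rewrite /endo_app; case: f => f [[fD] [fZ]]; case: g => g [[gD] [gZ]] /= /funext.
move=> fg; subst g; congr GRing.Linear.Pack; congr GRing.Linear.Class.
  by congr GRing.isNmodMorphism.Axioms_; exact: Prop_irrelevance.
by congr GRing.isScalable.Axioms_; exact: Prop_irrelevance.
Qed.

Fact endo_addA : associative endo_add.
Proof. by move=> f g h; apply: endoP => x /=; exact: addrA. Qed.
Fact endo_addC : commutative endo_add.
Proof. by move=> f g; apply: endoP => x /=; exact: addrC. Qed.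
Fact endo_add0 : left_id endo_zero endo_add.
Proof. by move=> f; apply: endoP => x /=; exact: add0r. Qed.
Fact endo_addN : left_inverse endo_zero endo_opp endo_add.
Proof. by move=> f; apply: endoP => x /=; exact: addNr. Qed.

HB.instance Definition _ :=
  GRing.isZmodule.Build endo endo_addA endo_addC endo_add0 endo_addN.

Fact endo_mulA : associative endo_mul.
Proof. by move=> f g h; exact: endoP. Qed.
Fact endo_mul1 : left_id endo_one endo_mul.
Proof. by move=> f; exact: endoP. Qed.
Fact endo_1mul : right_id endo_one endo_mul.
Proof. by move=> f; exact: endoP. Qed.
Fact endo_mulDl : left_distributive endo_mul +%R.
Proof. by move=> f g h; exact: endoP. Qed.
Fact endo_mulDr : right_distributive endo_mul +%R.
Proof. by move=> f g h; apply: endoP => x; exact: raddfD. Qed.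

HB.instance Definition _ := GRing.Zmodule_isPzRing.Build endo
  endo_mulA endo_mul1 endo_1mul endo_mulDl endo_mulDr.

End EndomorphismRing.

Section Jacobson.
Variable A : pzRingType.

Definition right_ideal (I : set A) : Prop :=
  [/\ I 0, (forall x y, I x -> I y -> I (x + y)) &
      (forall x r, I x -> I (x * r))].

Definition maximal_right_ideal (I : set A) : Prop :=
  [/\ right_ideal I, ~ I 1 &
      forall K : set A, right_ideal K -> ~ K 1 -> (I `<=` K)%classic ->
        K = I].

Definition jacobson : {pred A} :=
  fun x => `[< forall I, maximal_right_ideal I -> I x >].

Lemma jacobsonP x :
  reflect (forall I, maximal_right_ideal I -> I x) (x \in jacobson).
Proof. exact: asboolP. Qed.

Fact jacobson_zmod : zmod_closed jacobson.
Proof.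
split=> [|x y /jacobsonP Jx /jacobsonP Jy]; apply/jacobsonP => I mI.
  by case: (mI) => -[].
case: (mI) => -[_ ID IM] _ _; apply: ID; first exact: Jx.
by rewrite -mulrN1; apply: IM; exact: Jy.
Qed.

HB.instance Definition _ := GRing.isZmodClosed.Build A jacobson jacobson_zmod.

Lemma jacobsonMr x r : x \in jacobson -> x * r \in jacobson.
Proof.
move=> /jacobsonP Jx; apply/jacobsonP => I mI.
by case: (mI) => -[_ _ IM] _ _; apply: IM; exact: Jx.
Qed.

Lemma jacobsonMl a x : x \in jacobson -> a * x \in jacobson.
Proof.
move=> /jacobsonP Jx; apply/jacobsonP => I mI.
case: (mI) => -[I0 ID IM] nI1 maxI.
case: (pselect (I a)) => [Ia|nIa]; first exact: IM.
have ID' u v : I (u + v) -> I v -> I u.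
  by move=> Iuv /IM-/(_ (-1)); rewrite mulrN1 => /(ID _ _ Iuv); rewrite addrK.
apply: (Jx [set y | I (a * y)]%classic); split=> /=; last first.
- move=> K [K0 KD KM] nK1 sK; apply/seteqP; split=> [y Ky|]; last exact: sK.
  apply: contrapT => nIay; apply: nK1.
  pose T : set A := [set z | exists m r, I m /\ z = m + a * y * r]%classic.
  have [Ta|nTa] := pselect (T a).
    case: Ta => m [r [Im def_a]].
    have : K (1 - y * r).
      by apply: sK => /=; rewrite mulrBr mulr1 {1}def_a mulrA addrK.
    by move=> /KD-/(_ (y * r) (KM _ _ Ky)); rewrite subrK.
  have rT : right_ideal T.
    split.
    - by exists 0, 0; rewrite mulr0 addr0.
    - move=> _ _ [m [r [Im ->]]] [m' [r' [Im' ->]]].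
      by exists (m + m'), (r + r'); split; [exact: ID | rewrite mulrDr addrACA].
    - move=> _ s [m [r [Im ->]]]; exists (m * s), (r * s).
      by split; [exact: IM | rewrite mulrDl !mulrA].
  have IT : (I `<=` T)%classic.
    by move=> m Im; exists m, 0; rewrite mulr0 addr0.
  have [T1|nT1] := pselect (T 1).
    by exfalso; apply: nTa; rewrite -[a]mul1r; case: rT => _ _; apply.
  exfalso; apply: nIay; rewrite -(maxI T rT nT1 IT).
  by exists 0, 1; rewrite mulr1 add0r.
- by rewrite mulr1.
- split=> /= [|u v Iu Iv|u r Iu]; first by rewrite mulr0.
    by rewrite mulrDr; exact: ID.
  by rewrite mulrA; exact: IM.
Qed.

Definition quotJ : Type := Quotient.quot jacobson.

HB.instance Definition _ := GRing.Zmodule.on quotJ.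
HB.instance Definition _ := EqQuotient.on quotJ.

Definition quotJ_one : quotJ := lift_cst quotJ 1.
Definition quotJ_mul := lift_op2 quotJ *%R.

Canonical pi_quotJ_one := PiConst quotJ_one.

Lemma quotJ_pi_mul : {morph \pi : x y / x * y >-> quotJ_mul x y}.
Proof.
move=> x y; unlock quotJ_mul; apply/eqP; rewrite piE Quotient.equivE.
rewrite -[_ * _](addrNK (x * repr (\pi_quotJ y))) -mulrBr.
rewrite -addrA -mulrBl rpredD //.
  by rewrite jacobsonMl // Quotient.idealrDE opprK reprK.
by rewrite jacobsonMr // Quotient.idealrDE opprK reprK.
Qed.
Canonical pi_quotJ_mul := PiMorph2 quotJ_pi_mul.

Fact quotJ_mulA : associative quotJ_mul.
Proof. by move=> x y z; rewrite -[x]reprK -[y]reprK -[z]reprK !piE mulrA. Qed.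
Fact quotJ_mul1 : left_id quotJ_one quotJ_mul.
Proof. by move=> x; rewrite -[x]reprK !piE mul1r. Qed.
Fact quotJ_1mul : right_id quotJ_one quotJ_mul.
Proof. by move=> x; rewrite -[x]reprK !piE mulr1. Qed.
Fact quotJ_mulDl : left_distributive quotJ_mul +%R.
Proof.
move=> x y z; rewrite -[x]reprK -[y]reprK -[z]reprK.
by apply/eqP; rewrite piE /= mulrDl Quotient.equivE subrr rpred0.
Qed.
Fact quotJ_mulDr : right_distributive quotJ_mul +%R.
Proof.
move=> x y z; rewrite -[x]reprK -[y]reprK -[z]reprK.
by apply/eqP; rewrite piE /= mulrDr Quotient.equivE subrr rpred0.
Qed.

HB.instance Definition _ := GRing.Zmodule_isPzRing.Build quotJ
  quotJ_mulA quotJ_mul1 quotJ_1mul quotJ_mulDl quotJ_mulDr.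

Definition idempotents_lift_mod_J : Prop :=
  forall x : quotJ, x * x = x -> exists2 e : A, e * e = e & \pi_quotJ e = x.

End Jacobson.

Arguments right_ideal : clear implicits.
Arguments maximal_right_ideal : clear implicits.
Arguments jacobson : clear implicits.

Definition von_neumann_regular (A : pzRingType) : Prop :=
  forall a : A, exists x : A, a * x * a = a.

Definition abelian_regular (A : pzRingType) : Prop :=
  von_neumann_regular A /\ (forall e : A, e * e = e -> forall x, e * x = x * e).

Definition injective_module (S : pzRingType) (Q : lmodType S) : Prop :=
  forall (U V : lmodType S) (i : {linear U -> V}) (f : {linear U -> Q}),
    injective i -> exists g : {linear V -> Q}, g \o i =1 f.

(* [A^c^o] is A as a right module over itself: r *: x is the product x r in A. *)
Definition right_self_injective (A : pzRingType) : Prop :=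
  injective_module (A^c^o : rmodType A).

Definition ring_iso (A B : pzRingType) : Prop :=
  exists f : {rmorphism A -> B}, bijective f.

Definition lmod_iso (S : pzRingType) (U V : lmodType S) : Prop :=
  exists f : {linear U -> V}, bijective f.

Record direct_sum (S : pzRingType) (M N L : lmodType S) := DirectSum {
  dsum_inj1 : {linear N -> M};
  dsum_inj2 : {linear L -> M};
  dsum_proj1 : {linear M -> N};
  dsum_proj2 : {linear M -> L};
  dsum_proj1_inj1 : forall x, dsum_proj1 (dsum_inj1 x) = x;
  dsum_proj2_inj2 : forall y, dsum_proj2 (dsum_inj2 y) = y;
  dsum_proj1_inj2 : forall y, dsum_proj1 (dsum_inj2 y) = 0;
  dsum_proj2_inj1 : forall x, dsum_proj2 (dsum_inj1 x) = 0;
  dsum_inj_proj : forall z, dsum_inj1 (dsum_proj1 z) + dsum_inj2 (dsum_proj2 z) = z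
}.

Definition direct_summand (S : pzRingType) (N M : lmodType S) : Prop :=
  exists L : lmodType S, inhabited (direct_sum M N L).

Section HomAsEnd.
Variables (S : pzRingType) (M N L : lmodType S) (D : direct_sum M N L).

Definition hom12_endo (f : {linear N -> L}) : endo M :=
  (dsum_inj2 D \o f \o dsum_proj1 D : {linear M -> M}).

Definition hom21_endo (f : {linear L -> N}) : endo M :=
  (dsum_inj1 D \o f \o dsum_proj2 D : {linear M -> M}).

End HomAsEnd.

Definition square_free (S : pzRingType) (N : lmodType S) : Prop :=
  ~ exists N1 N2 N3 : lmodType S,
      [/\ lmod_iso (N1 * N2 * N3)%type N, lmod_iso N1 N2 &
          exists x : N2, x != 0].

Section Covers.
Variables (S : pzRingType) (cX : lmodType S -> Prop).

Definition closed_under_iso : Prop :=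
  forall U V : lmodType S, lmod_iso U V -> cX U -> cX V.

Definition X_precover (X M : lmodType S) (p : {linear X -> M}) : Prop :=
  cX X /\ forall (Y : lmodType S) (q : {linear Y -> M}), cX Y ->
            exists h : {linear Y -> X}, p \o h =1 q.

Definition X_cover (X M : lmodType S) (p : {linear X -> M}) : Prop :=
  X_precover p /\ forall h : {linear X -> X}, p \o h =1 p -> bijective h.

Definition has_X_cover (M : lmodType S) : Prop :=
  exists (X : lmodType S) (p : {linear X -> M}), X_cover p.

Definition epimorphic (X M : lmodType S) (p : {linear X -> M}) : Prop :=
  forall m : M, exists x : X, p x = m.

Definition X_automorphism_coinvariant (M : lmodType S) : Prop :=
  exists (X : lmodType S) (p : {linear X -> M}), X_cover p /\
    forall g : {linear X -> X}, bijective g ->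
      exists f : {linear M -> M}, f \o p =1 p \o g.

Definition X_endomorphism_coinvariant (M : lmodType S) : Prop :=
  exists (X : lmodType S) (p : {linear X -> M}), X_cover p /\
    forall g : {linear X -> X},
      exists f : {linear M -> M}, f \o p =1 p \o g.

End Covers.

(* Main.v *)
(* Every endomorphism s of M lifts along p to some g in End(X), unique modulo
   J = J(End X). Units of End(X)/J lift to automorphisms of X, hence descend to
   M, and so do the elements of J; thus the elements that descend form the
   preimage of a subring T of Q = End(X)/J containing all units, and
   End(M)/J(End M) is isomorphic to T.
   Since 1 + e x (1 - e) is a unit for every idempotent e of Q, the ideals
   Q e Q (1 - e) Q lie in T. Choose (Zorn) a maximal isomorphism between
   independent right ideals of Q; by injectivity it is an isomorphism of eQ
   onto fQ with e, f orthogonal idempotents, and for g = 1 - e - f the ring gQg is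
   abelian. A maximal isomorphism between submodules of gQ and of eQ splits g
   as g1 + z with g1 isomorphic to a summand of eQ. Then z is central, zQ is
   abelian regular, and 1 - z = e + f + g1 lies in QeQ(1 - e)Q, so that
   (1 - z)Q is contained in T.
   The idempotent 1 - z lifts to End(X) and descends to the projection of M onto
   L. On the complement N, a strongly regular element x of zQ is x u x with u a
   unit, so zT is again abelian regular. *)

From HB Require Import structures.
Require Import Defs.
From mathcomp Require Import all_boot all_algebra.
From mathcomp Require Import boolp classical_sets.

Set Implicit Arguments.
Unset Strict Implicit.
Unset Printing Implicit Defensive.

Import GRing.Theory.
Local Open Scope ring_scope.
Local Open Scope quotient_scope.

(** * Submodules and the Jacobson radical *)

Section Submodules.
Variables (S : pzRingType) (V : lmodType S).

Definition submodule (K : set V) : Prop :=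
  [/\ K 0, (forall x y, K x -> K y -> K (x + y)) &
      (forall a x, K x -> K (a *: x))].

Lemma submoduleN (K : set V) x : submodule K -> K x -> K (- x).
Proof. by case=> _ _ KZ Kx; rewrite -scaleN1r; exact: KZ. Qed.

Record submod := Submod { submod_set : set V; submodP : submodule submod_set }.

Definition submod_pred (K : submod) : {pred V} :=
  fun x => `[< submod_set K x >].

Lemma submod_predP (K : submod) x : reflect (submod_set K x) (x \in submod_pred K).
Proof. exact: asboolP. Qed.

Fact submod_pred_closed K : submod_closed (submod_pred K).
Proof.
have [K0 KD KZ] := submodP K.
split=> [|a x y /submod_predP Kx /submod_predP Ky]; apply/submod_predP => //.
by apply: KD => //; exact: KZ.
Qed.

HB.instance Definition _ K :=
  GRing.isSubmodClosed.Build S V (submod_pred K) (submod_pred_closed K).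

Definition submod_type (K : submod) : Type := {x | x \in submod_pred K}.

HB.instance Definition _ K := SubChoice.on (submod_type K).
HB.instance Definition _ K :=
  [SubChoice_isSubZmodule of submod_type K by <:].
HB.instance Definition _ K :=
  [SubZmodule_isSubLmodule of submod_type K by <:].

(* A property of pairs of elements passes to unions of chains, so Zorn's lemma
   yields a submodule maximal among those satisfying it. *)
Lemma maximal_submodule (phi : V -> V -> Prop) (K0 : set V) :
    submodule K0 -> (forall x y, K0 x -> K0 y -> phi x y) ->
  exists K : set V,
    [/\ submodule K, (forall x y, K x -> K y -> phi x y), (K0 `<=` K)%classic &
        forall K', submodule K' -> (forall x y, K' x -> K' y -> phi x y) ->
          (K `<=` K')%classic -> (K' `<=` K)%classic].
Proof.
move=> sK0 phiK0.
pose P (K : set V) := submodule (K0 `|` K)%classic /\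
  forall x y, (K0 `|` K)%classic x -> (K0 `|` K)%classic y -> phi x y.
have [F FP totF|K [[sK phiK] maxK]] := @Zorn_bigcup V P.
  have lub x y : (K0 `|` \bigcup_(K in F) K)%classic x ->
      (K0 `|` \bigcup_(K in F) K)%classic y ->
      exists K, [/\ submodule K, (forall u v, K u -> K v -> phi u v), K x, K y &
        (K `<=` K0 `|` \bigcup_(K in F) K)%classic].
    have sub K : F K -> (K0 `|` K `<=` K0 `|` \bigcup_(K in F) K)%classic.
      by move=> FK u [?|Ku]; [left | right; exists K].
    move=> [K0x|[K FK Kx]] [K0y|[K' FK' K'y]].
    - by exists K0; split=> // u ?; left.
    - have [sK' phiK'] := FP _ FK'.
      by exists (K0 `|` K')%classic; split=> //; [left | right | exact: sub].
    - have [sK phiK] := FP _ FK.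
      by exists (K0 `|` K)%classic; split=> //; [right | left | exact: sub].
    - have [KK'|K'K] := totF _ _ FK FK'.
        have [sK' phiK'] := FP _ FK'.
        exists (K0 `|` K')%classic; split=> //; last exact: sub.
          by right; exact: KK'.
        by right.
      have [sK phiK] := FP _ FK.
      exists (K0 `|` K)%classic; split=> //; last exact: sub.
        by right.
      by right; exact: K'K.
  split; last first.
    by move=> x y Hx Hy; have [K [_ phiK Kx Ky _]] := lub _ _ Hx Hy; exact: phiK.
  split; first by left; case: sK0.
    move=> x y Hx Hy; have [K [[_ KD _] _ Kx Ky KF]] := lub _ _ Hx Hy.
    by apply: KF; exact: KD.
  move=> a x Hx; have [K [[_ _ KZ] _ Kx _ KF]] := lub _ _ Hx Hx.
  by apply: KF; exact: KZ.
exists (K0 `|` K)%classic; split=> // K' sK' phiK' KK'.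
apply: contrapT => nK'K; have K0K' : (K0 `|` K' = K')%classic.
  by apply/setUidPr => x K0x; apply: KK'; left.
apply: (maxK K'); last by rewrite /P K0K'.
split=> [x Kx|K'K]; first by apply: KK'; right.
by apply: nK'K => x /K'K Kx; right.
Qed.

End Submodules.

Notation "x %:J" := (\pi_(quotJ _) x) (at level 2, format "x %:J").

Section JacobsonRadical.
Variable A : pzRingType.
Implicit Types x y r : A.

Lemma submodule_right_ideal (I : set A) :
  right_ideal A I <-> @submodule A^c A^c^o I.
Proof. by split=> -[I0 ID IM]; split=> // a x; exact: IM. Qed.

(** If [(1 - x) A] were proper, it would lie in a maximal right ideal, which also contains [x] and
    hence 1. *)
Lemma jacobson_rinv x : x \in jacobson A -> exists y, (1 - x) * y = 1.
Proof.
move=> /jacobsonP Jx; apply: contrapT => nx.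
pose I : set A := [set u | exists r, u = (1 - x) * r]%classic.
have sI : @submodule A^c A^c^o I.
  split=> [|_ _ [r ->] [r' ->]|a _ [r ->]]; first by exists 0; rewrite mulr0.
    by exists (r + r'); rewrite mulrDr.
  by exists (r * a); rewrite mulrA.
(* For a right ideal, [u <> 1] for all members means properness, so [K] is a maximal right ideal. *)
have [u v [r ->] _|K [sK phiK IK maxK]] :=
  @maximal_submodule A^c A^c^o (fun u _ => u <> 1 :> A) I sI.
  by move=> e; apply: nx; exists r.
have mK : maximal_right_ideal A K.
  split; first exact/submodule_right_ideal.
    by move=> K1; exact: (phiK _ _ K1 K1).
  move=> L /submodule_right_ideal sL nL1 KL; apply/seteqP; split=> //.
  by apply: maxK => // u v Lu _ u1; apply: nL1; rewrite -u1.
have Kx := Jx _ mK; case: (sK) => _ KD _.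
case: mK => _ nK1 _; apply: nK1; rewrite -[1](subrK x); apply: KD => //.
by apply: IK; exists 1; rewrite mulr1.
Qed.

(** A right inverse [y] equals [1 + x y], so it has a right inverse of its own, which must be
    [1 - x]. *)
Lemma jacobson_inv x :
  x \in jacobson A -> exists y, (1 - x) * y = 1 /\ y * (1 - x) = 1.
Proof.
move=> Jx; have [y xy1] := jacobson_rinv Jx; exists y; split=> //.
have yE : y = 1 - (- (x * y)).
  by rewrite opprK -[in RHS]xy1 mulrBl mul1r subrK.
have [w] : exists w, (1 - (- (x * y))) * w = 1.
  by apply: jacobson_rinv; rewrite rpredN jacobsonMr.
rewrite -yE => yw1; suff <- : w = 1 - x by [].
have : (1 - x) * (y * w) = w by rewrite mulrA xy1 mul1r.
by rewrite yw1 mulr1.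
Qed.

(** If a maximal right ideal [I] misses [x], then [1 = m + x r] with [m] in [I], and [m = 1 - x r]
    is right invertible. *)
Lemma jacobson_rinvP x :
  (forall r, exists y, (1 - x * r) * y = 1) -> x \in jacobson A.
Proof.
move=> xr; apply/jacobsonP => I mI; apply: contrapT => nIx.
case: (mI) => -[I0 ID IM] nI1 maxI.
pose T : set A := [set z | exists m r, I m /\ z = m + x * r]%classic.
have rT : right_ideal A T.
  split; first by exists 0, 0; rewrite mulr0 addr0.
    move=> _ _ [m [r [Im ->]]] [m' [r' [Im' ->]]].
    by exists (m + m'), (r + r'); split; [exact: ID | rewrite mulrDr addrACA].
  move=> _ s [m [r [Im ->]]]; exists (m * s), (r * s).
  by split; [exact: IM | rewrite mulrDl !mulrA].
have IT : (I `<=` T)%classic by move=> m Im; exists m, 0; rewrite mulr0 addr0.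
have [[m [r [Im e1]]]|nT1] := pselect (T 1).
  have [y] := xr r; rewrite {1}e1 addrK => my1.
  by apply: nI1; rewrite -my1; exact: IM.
by apply: nIx; rewrite -(maxI T rT nT1 IT); exists 0, 1; rewrite mulr1 add0r.
Qed.

Lemma jacobson_idem x : x \in jacobson A -> x * x = x -> x = 0.
Proof.
move=> /jacobson_rinv[y xy1] xx.
by rewrite -[x]mulr1 -xy1 mulrA mulrBr mulr1 xx subrr mul0r.
Qed.

Lemma quotJ_eq x y : x%:J = y%:J <-> x - y \in jacobson A.
Proof.
split=> [/eqP|Jxy]; first by rewrite piE Quotient.equivE.
by apply/eqP; rewrite piE Quotient.equivE.
Qed.

Lemma quotJ_piD x y : (x + y)%:J = x%:J + y%:J.
Proof. by rewrite piE. Qed.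

Lemma quotJ_piB x y : (x - y)%:J = x%:J - y%:J.
Proof. by rewrite !piE. Qed.

Lemma quotJ_piM x y : (x * y)%:J = x%:J * y%:J.
Proof. by rewrite piE. Qed.

Lemma quotJ_pi1 : (1 : A)%:J = 1.
Proof. by rewrite piE. Qed.

Lemma quotJ_pi0 : (0 : A)%:J = 0.
Proof. by rewrite piE. Qed.

Lemma quotJ_eq0 x : x%:J = 0 <-> x \in jacobson A.
Proof.
by rewrite -quotJ_pi0; split=> [/quotJ_eq|Jx]; last apply/quotJ_eq; rewrite subr0.
Qed.

Lemma quotJ_surj (x : quotJ A) : exists a, a%:J = x.
Proof. by exists (repr x); rewrite reprK. Qed.

End JacobsonRadical.

(** * Regular right self-injective rings *)

Section SelfInjective.
Variable Q : pzRingType.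
Implicit Types a b c d e f g h k l m s t x y : Q.

(** Injectivity in terms of elements: a right linear endomorphism of [Q] is left multiplication by
    the image of 1. The map [i] is injective on [K] only, so that it may be a sum map out of a
    product of modules. *)
Lemma self_injective_extension (V : rmodType Q) (K : set V)
    (i f : {linear V -> (Q^c^o : rmodType Q)}) :
    right_self_injective Q -> submodule K ->
    (forall v, K v -> i v = 0 -> v = 0) ->
  exists c : Q, forall v, K v -> f v = c * (i v : Q).
Proof.
move=> injQ sK iK; pose W := submod_type (Submod sK).
pose j : {linear W -> (Q^c^o : rmodType Q)} := i \o val.
have inj_j : injective j.
  move=> v w /eqP; rewrite -subr_eq0 -raddfB => /eqP jvw.
  apply/eqP; rewrite -subr_eq0; apply/eqP/val_inj; rewrite raddf0.
  apply: iK jvw; exact: elimT (submod_predP (Submod sK) _) (valP (v - w)).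
have [g gj] := injQ _ _ j (f \o val : {linear W -> (Q^c^o : rmodType Q)}) inj_j.
exists (g 1) => v Kv.
have Wv : v \in submod_pred (Submod sK) by exact/submod_predP.
have /= <- := gj (Sub v Wv : W).
rewrite -[LHS]/(g (i v)) -[i v in LHS](mul1r (i v : Q)).
exact: (linearZ_LR g (i v : Q^c) (1 : Q^c^o)).
Qed.

Lemma regular_inverse :
  von_neumann_regular Q -> forall x, exists2 y, x * y * x = x & y * x * y = y.
Proof.
move=> regQ x; have [y xyx] := regQ x; exists (y * x * y).
  by rewrite !mulrA !xyx.
have -> : y * x * y * x * (y * x * y) = y * (x * y * x * y * x) * y.
  by rewrite !mulrA.
by rewrite !xyx.
Qed.

(** Regular rings are nonsingular: if [d y d = d] with [d] nonzero, some nonzero [y d t] lies in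
    [K], and then [d t = d y d t = 0]. *)
Lemma regular_essential_annihilator (K : set Q) d :
    von_neumann_regular Q ->
    (forall x, x <> 0 -> exists t, K (x * t) /\ x * t <> 0) ->
    (forall x, K x -> d * x = 0) ->
  d = 0.
Proof.
move=> regQ essK dK; have [y dyd] := regQ d.
apply: contrapT => d0; have [|t [Kt]] := essK (y * d).
  by move=> yd0; apply: d0; rewrite -dyd -mulrA yd0 mulr0.
by apply; have := dK _ Kt; rewrite !mulrA dyd -mulrA => ->; rewrite mulr0.
Qed.

(* A pair in [G] matches an element of [k Q] with one of [l Q]; [e] and [f]
   project onto the closures of the domain and of the range of [G], along each
   other and along a complement [C], and [a], [b] extend the two directions. *)
Lemma maximal_matching k l :
    von_neumann_regular Q -> right_self_injective Q ->
  exists a b e f,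
    [/\ [/\ a * b = e, b * a = f, e * a = a & f * b = b],
        [/\ e * e = e, f * f = f, e * f = 0 & f * e = 0],
        k * e = e, l * f = f &
        forall h m, h * h = h -> m * m = m -> k * h = h -> l * m = m ->
          e * h = 0 -> f * m = 0 ->
          (forall s t s' t', e * s + h * t = f * s' + m * t' ->
             e * s + h * t = 0) ->
          forall u, h * u * m = 0].
Proof.
move=> regQ injQ.
pose V : rmodType Q := (Q^c^o * Q^c^o)%type.
(* For a submodule [G], the third clause makes [G] the graph of an isomorphism, and the fourth makes
   its domain and range independent. *)
pose phi (v w : V) := [/\ k * (v.1 : Q) = v.1, l * (v.2 : Q) = v.2,
  (v.1 = 0 <-> v.2 = 0) & (v.1 = w.2 -> v.1 = 0)].
have [|v w -> _|G [sG phiG _ maxG]] := @maximal_submodule Q^c V phi [set 0]%classic.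
- by split=> [//|_ _ -> ->|a _ ->]; rewrite ?addr0 ?scaler0.
- by split; rewrite /= ?mulr0.
have [G0 GD GZ] := sG.
have eqG0 v w : G v -> G w -> v.1 = w.2 -> v = 0 /\ w = 0.
  move=> Gv Gw vw; have [_ _ v12 /(_ vw) v1] := phiG v w Gv Gw.
  have [_ _ w12 _] := phiG w w Gw Gw.
  move/v12: (v1) => v2; have w2 : w.2 = 0 by rewrite -vw.
  move/w12: (w2) => w1.
  by split; [case: v v1 v2 {Gv vw v12} | case: w w1 w2 {Gw vw w12}] => x y /= -> ->.
(* [H] is the sum of the domain and the range of [G], and [C] below is a right ideal maximal among
   those meeting [H] in 0. *)
pose H : set Q^c^o :=
  [set x | exists v w, [/\ G v, G w & x = v.1 + w.2]]%classic.
have sH : submodule H.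
  split=> [|_ _ [v [w [Gv Gw ->]]] [v' [w' [Gv' Gw' ->]]]|c _ [v [w [Gv Gw ->]]]].
  - by exists 0, 0; rewrite /= addr0.
  - by exists (v + v'), (w + w'); split; [exact: GD | exact: GD | exact: addrACA].
  - by exists (c *: v), (c *: w); split; [exact: GZ | exact: GZ | rewrite scalerDr].
have [|x y -> _ _|C [sC HC _ maxC]] :=
    @maximal_submodule Q^c Q^c^o (fun x _ => H x -> x = 0) [set 0]%classic.
- by split=> [//|_ _ -> ->|a _ ->]; rewrite ?addr0 ?scaler0.
- by [].
(* The sum map [i] is injective on [K] with image [H + C], so a linear map on [H + C] may be given
   on the three components separately. *)
pose W : rmodType Q := (V * V * Q^c^o)%type.
pose K : set W := [set w | [/\ G w.1.1, G w.1.2 & C w.2]]%classic.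
have [C0 CD CZ] := sC.
have sK : submodule K.
  split=> //= [w w' [? ? ?] [? ? ?]|c w [? ? ?]].
    by split=> /=; [exact: GD | exact: GD | exact: CD].
  by split=> /=; [exact: GZ | exact: GZ | exact: CZ].
pose i : {linear W -> (Q^c^o : rmodType Q)} :=
  (fst \o (fst \o fst)) \+ (snd \o (snd \o fst)) \+ snd.
have iK w : K w -> i w = 0 -> w = 0.
  case: w => -[v w] c [/= Gv Gw Cc] /eqP; rewrite addr_eq0 => /eqP vwc.
  have c0 : c = 0.
    apply: (HC c c Cc Cc); exists (- v), (- w); split; try exact: submoduleN.
    by rewrite -[LHS]opprK -vwc opprD.
  move/eqP: vwc; rewrite c0 oppr0 addr_eq0 => /eqP vw.
  by have [-> /eqP] := eqG0 v (- w) Gv (submoduleN sG Gw) vw; rewrite oppr_eq0 => /eqP ->.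
have ext (tau : {linear W -> (Q^c^o : rmodType Q)}) : exists c,
    [/\ (forall x y, G (x, y) -> c * x = tau ((x, y), 0, 0)),
        (forall x y, G (x, y) -> c * y = tau (0, (x, y), 0)) &
        (forall x, C x -> c * x = tau (0, 0, x))].
  have [c cE] := self_injective_extension tau injQ sK iK; exists c.
  split=> [x y Gxy|x y Gxy|x Cx].
  - by rewrite cE //= /i /= !addr0.
  - by rewrite cE //= /i /= addr0 add0r.
  - by rewrite cE //= /i /= !add0r.
(* [H + C] is essential: if no nonzero multiple of [x] lies in it, then [C + x Q] still meets [H] in
   0, so [x] is in [C] by maximality. *)
have extP d : (forall x y, G (x, y) -> d * x = 0) ->
    (forall x y, G (x, y) -> d * y = 0) -> (forall x, C x -> d * x = 0) -> d = 0.
  move=> d1 d2 d3.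
  pose E : set Q := [set x | exists2 w, K w & x = i w]%classic.
  apply: (@regular_essential_annihilator E) => // [x x0|_ [[[v w] c] [/= Gv Gw Cc] ->]].
    apply: contrapT => nEx.
    have xE t : E (x * t) -> x * t = 0.
      by move=> Et; apply: contrapT => xt0; apply: nEx; exists t.
    pose C' : set Q^c^o := [set y | exists c t, C c /\ y = c + x * t]%classic.
    have sC' : submodule C'.
      split=> [|_ _ [c [t [Cc ->]]] [c' [t' [Cc' ->]]]|b _ [c [t [Cc ->]]]].
      - by exists 0, 0; rewrite mulr0 addr0.
      - exists (c + c'), (t + t'); split; first exact: CD.
        by rewrite mulrDr; exact: addrACA.
      - exists (c * (b : Q)), (t * (b : Q)); split; first exact: (CZ b c).
        by rewrite mulrA -mulrDl.
    have CC' : (C `<=` C')%classic by move=> c Cc; exists c, 0; rewrite mulr0 addr0.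
    have HC' y z : C' y -> C' z -> H y -> y = 0.
      move=> [c [t [Cc ->]]] _ [v [w [Gv Gw vw]]].
      have xt0 : x * t = 0.
        apply: xE; exists (v, w, - c); first by split=> //; exact: (submoduleN sC Cc).
        by rewrite /i /= -vw addrC addKr.
      rewrite xt0 addr0 in vw *; apply: (HC c c Cc Cc).
      by exists v, w.
    have Cx : C x by apply: (maxC C') => //; exists 0, 1; rewrite mulr1 add0r.
    apply: x0; rewrite -[x]mulr1; apply: xE; rewrite mulr1.
    by exists (0, 0, x) => //; rewrite /i /= !add0r.
  case: v w Gv Gw => x y [x' y'] Gv Gw.
  by rewrite /i /= !mulrDr (d1 _ _ Gv) (d2 _ _ Gw) d3 // !addr0.
(* For a pair [(x, y)] of [G]: [e x = x], [f y = y], [b x = y], [a y = x]. All other values on the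
   three components are 0. *)
have [e [e1 e2 e3]] := ext (fst \o (fst \o fst) : {linear W -> (Q^c^o : rmodType Q)}).
have [f [f1 f2 f3]] := ext (snd \o (snd \o fst) : {linear W -> (Q^c^o : rmodType Q)}).
have [b [b1 b2 b3]] := ext (snd \o (fst \o fst) : {linear W -> (Q^c^o : rmodType Q)}).
have [a [a1 a2 a3]] := ext (fst \o (snd \o fst) : {linear W -> (Q^c^o : rmodType Q)}).
rewrite /= in e1 e2 e3 f1 f2 f3 b1 b2 b3 a1 a2 a3.
exists a, b, e, f.
have eqext c d : (forall x y, G (x, y) -> c * x = d * x) ->
    (forall x y, G (x, y) -> c * y = d * y) -> (forall x, C x -> c * x = d * x) ->
    c = d.
  move=> cd1 cd2 cd3; apply/eqP; rewrite -subr_eq0; apply/eqP.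
  apply: extP => [x y Gxy|x y Gxy|x Cx]; rewrite mulrBl.
  - by rewrite (cd1 _ _ Gxy) subrr.
  - by rewrite (cd2 _ _ Gxy) subrr.
  - by rewrite (cd3 _ Cx) subrr.
have ab : a * b = e.
  apply: eqext => [x y Gxy|x y Gxy|x Cx]; rewrite -mulrA.
  - by rewrite (b1 _ _ Gxy) (a2 _ _ Gxy) (e1 _ _ Gxy).
  - by rewrite (b2 _ _ Gxy) (e2 _ _ Gxy) mulr0.
  - by rewrite (b3 _ Cx) (e3 _ Cx) mulr0.
have ba : b * a = f.
  apply: eqext => [x y Gxy|x y Gxy|x Cx]; rewrite -mulrA.
  - by rewrite (a1 _ _ Gxy) (f1 _ _ Gxy) mulr0.
  - by rewrite (a2 _ _ Gxy) (b1 _ _ Gxy) (f2 _ _ Gxy).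
  - by rewrite (a3 _ Cx) (f3 _ Cx) mulr0.
have ea : e * a = a.
  apply: eqext => [x y Gxy|x y Gxy|x Cx]; rewrite -mulrA.
  - by rewrite (a1 _ _ Gxy) mulr0.
  - by rewrite (a2 _ _ Gxy) (e1 _ _ Gxy).
  - by rewrite (a3 _ Cx) mulr0.
have fb : f * b = b.
  apply: eqext => [x y Gxy|x y Gxy|x Cx]; rewrite -mulrA.
  - by rewrite (b1 _ _ Gxy) (f2 _ _ Gxy).
  - by rewrite (b2 _ _ Gxy) mulr0.
  - by rewrite (b3 _ Cx) mulr0.
have ee : e * e = e by rewrite -{2}ab mulrA ea.
have ff : f * f = f by rewrite -{2}ba mulrA fb.
have ef : e * f = 0.
  apply: extP => [x y Gxy|x y Gxy|x Cx]; rewrite -mulrA.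
  - by rewrite (f1 _ _ Gxy) mulr0.
  - by rewrite (f2 _ _ Gxy) (e2 _ _ Gxy).
  - by rewrite (f3 _ Cx) mulr0.
have fe : f * e = 0.
  apply: extP => [x y Gxy|x y Gxy|x Cx]; rewrite -mulrA.
  - by rewrite (e1 _ _ Gxy) (f1 _ _ Gxy).
  - by rewrite (e2 _ _ Gxy) mulr0.
  - by rewrite (e3 _ Cx) mulr0.
have ke : k * e = e.
  apply: eqext => [x y Gxy|x y Gxy|x Cx]; rewrite -mulrA.
  - by rewrite (e1 _ _ Gxy); case: (phiG _ _ Gxy Gxy).
  - by rewrite (e2 _ _ Gxy) mulr0.
  - by rewrite (e3 _ Cx) mulr0.
have lf : l * f = f.
  apply: eqext => [x y Gxy|x y Gxy|x Cx]; rewrite -mulrA.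
  - by rewrite (f1 _ _ Gxy) mulr0.
  - by rewrite (f2 _ _ Gxy); case: (phiG _ _ Gxy Gxy).
  - by rewrite (f3 _ Cx) mulr0.
split=> // h m hh mm kh lm eh fm indep u0.
(* From here on [u] is [h u0 m]. Its quasi-inverse is cut down to [y] in [m Q h]; with [p = u y],
   the pair [(p, y)] would extend the matching if [u] were nonzero. *)
have : (h * u0 * m) * m = h * u0 * m by rewrite -!mulrA mm.
have : h * (h * u0 * m) = h * u0 * m by rewrite !mulrA hh.
move: (h * u0 * m) => {u0} u hu um; have [y1 uy1u y1uy1] := regular_inverse regQ u.
have [y def_y] : exists y, y = m * y1 * h by eexists (m * y1 * h).
have uy : u * y = u * y1 * h by rewrite def_y !mulrA um.
have yu : y * u = m * y1 * u by rewrite def_y -!mulrA hu.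
have my : m * y = y by rewrite def_y !mulrA mm.
have uyu' : u * y * u = u by rewrite uy -mulrA hu uy1u.
have yuy : y * u * y = y.
  by rewrite -mulrA uy def_y -!mulrA; congr (m * _); rewrite (mulrA h u) hu !mulrA y1uy1.
have [p def_p] : exists p, p = u * y by eexists (u * y).
have hp : h * p = p by rewrite def_p mulrA hu.
have ep : e * p = 0 by rewrite -hp mulrA eh mul0r.
have fy : f * y = 0 by rewrite -my mulrA fm mul0r.
have eb : e * b = 0 by rewrite -fb mulrA ef mul0r.
(* [G'] adjoins [(p, y)] to the graph of [b] on [e Q], which contains [G]. Maximality puts [(p, y)]
   in [G], whence [p = e p = 0]. *)
pose G' : set V :=
  [set v | exists s t : Q, v = (e * s + p * t, b * s + y * t) :> Q * Q]%classic.
suff Gpy : G (p, y).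
  have := e1 _ _ Gpy; rewrite ep => p0.
  by rewrite -uyu' -def_p -p0 mul0r.
have sG' : submodule G'.
  split=> [|_ _ [s [t ->]] [s' [t' ->]]|c _ [s [t ->]]].
  - by eexists 0, 0; rewrite !mulr0 !addr0.
  - by eexists (s + s'), (t + t'); rewrite !mulrDr; congr (_, _); exact: addrACA.
  - by eexists (s * c), (t * c); rewrite !mulrA -!mulrDl.
apply: (maxG G' sG'); first last.
- by eexists 0, 1; rewrite !mulr1 !mulr0 !add0r.
- move=> [x z] Gxz; exists x, 0.
  by rewrite (e1 _ _ Gxz) (b1 _ _ Gxz) !mulr0 !addr0.
move=> _ _ [s [t ->]] [s' [t' ->]]; split=> /=.
- by rewrite mulrDr !mulrA ke -hp !mulrA kh.
- by rewrite mulrDr !mulrA -fb -my !mulrA lf lm.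
- split=> [ept|byt].
    have es : e * s = 0.
      by have := congr1 ( *%R e) ept; rewrite mulrDr !mulrA ee ep mul0r addr0 mulr0.
    move: ept; rewrite es add0r => pt.
    have be : b * e = b by rewrite -ab mulrA ba fb.
    by rewrite -be -mulrA es mulr0 -yuy -!mulrA (mulrA u) -def_p pt mulr0 addr0.
  have bs : b * s = 0.
    by have := congr1 ( *%R f) byt; rewrite mulrDr !mulrA fb fy mul0r addr0 mulr0.
  move: byt; rewrite bs add0r => yt.
  by rewrite -ab -mulrA bs mulr0 def_p -mulrA yt mulr0 addr0.
rewrite -hp -fb -my -!mulrA; exact: indep.
Qed.

(* The transvections [1 + e x (1 - e)] are units. *)
Lemma transvection_ideal (P : Q -> Prop) e :
    (forall x y, P x -> P y -> P (x - y)) ->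
    (forall x y, P x -> P y -> P (x * y)) ->
    (forall x y, x * y = 1 -> y * x = 1 -> P x) ->
    e * e = e ->
  forall x y t, P (x * e * y * (1 - e) * t).
Proof.
move=> PB PM PU ee.
have P1 : P 1 by apply: (PU 1 1); rewrite mulr1.
have P0 : P 0 by rewrite -(subrr 1); exact: PB.
have PD x y : P x -> P y -> P (x + y).
  by move=> Px Py; rewrite -[y]opprK -[- y]sub0r; exact: PB Px (PB _ _ P0 Py).
have transv f g x : f * g = 0 -> g * f = 0 -> P (f * x * g).
  move=> fg gf; have n0 : (f * x * g) * (f * x * g) = 0.
    by rewrite -!mulrA (mulrA g) gf mul0r !mulr0.
  have -> : f * x * g = (1 + f * x * g) - 1 by rewrite addrC addKr.
  apply: PB P1; apply: (PU _ (1 - f * x * g)).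
    by rewrite mulrDl mul1r mulrBr mulr1 n0 subr0 subrK.
  by rewrite mulrBl mul1r mulrDr mulr1 n0 addr0 addrK.
have ee' : e * (1 - e) = 0 by rewrite mulrBr mulr1 ee subrr.
have e'e : (1 - e) * e = 0 by rewrite mulrBl mul1r ee subrr.
move: (1 - e) (subrKC e 1) ee' e'e => e' e1 ee' e'e x y t.
have ee1 : e' * e' = e'.
  by have := congr1 ( *%R e') e1; rewrite mulrDr mulr1 e'e add0r.
have Pee' u : P (e * u * e') by exact: transv.
have Pe'e u : P (e' * u * e) by exact: transv.
(* Peirce decomposition: the two diagonal corners are products of off-diagonal elements. *)
have -> : x * e * y * e' * t =
    (e * (x * e * y) * e') * (e' * t * e) + e * (x * e * y * e' * t) * e' +
    (e' * (x * e * y * e' * t) * e + (e' * x * e) * (e * (y * e' * t) * e')).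
  have dec u : u = e * u * e + e * u * e' + (e' * u * e + e' * u * e').
    by rewrite -!mulrDr -!mulrDl e1 mul1r mulr1.
  rewrite {1}[LHS]dec; congr (_ + _ + (_ + _)); rewrite !mulrA.
    by rewrite -(mulrA _ e' e') ee1.
  by rewrite -(mulrA _ e e) ee.
by apply: (PD); apply: (PD) => //; apply: (PM).
Qed.

(** Regularity writes [m x h] as [m x h y m x h], in which the vanishing factor [h y m] occurs. *)
Lemma regular_zero_sym h m :
  von_neumann_regular Q -> (forall x, h * x * m = 0) -> forall x, m * x * h = 0.
Proof.
move=> regQ hm x; have [y <-] := regQ (m * x * h).
have -> : m * x * h * y * (m * x * h) = m * x * (h * y * m) * x * h.
  by rewrite !mulrA.
by rewrite hm mulr0 !mul0r.
Qed.

(** The predicates [P] range over the subrings of [Q] containing all units; the last clause puts the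
    ideal [(1 - z) Q] into each of them. *)
Theorem abelian_unit_decomposition :
    von_neumann_regular Q -> right_self_injective Q ->
  exists z, [/\ z * z = z, forall x, z * x = x * z,
    forall h, h * h = h -> z * h = h -> forall x, h * x = x * h &
    forall P : Q -> Prop,
      (forall x y, P x -> P y -> P (x - y)) ->
      (forall x y, P x -> P y -> P (x * y)) ->
      (forall x y, x * y = 1 -> y * x = 1 -> P x) ->
      forall x, P ((1 - z) * x)].
Proof.
move=> regQ injQ.
have [a [b [e [f [[ab ba ea fb] [ee ff ef fe] _ _ max1]]]]] :=
  maximal_matching 1 1 regQ injQ.
have ae : a = a * f by rewrite -ba mulrA ab ea.
have be : b = b * e by rewrite -ab mulrA ba fb.
pose g := 1 - e - f.
have ge : g * e = 0 by rewrite /g !mulrBl mul1r ee fe subrr subr0.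
have gf : g * f = 0 by rewrite /g !mulrBl mul1r ff ef subr0 subrr.
have eg : e * g = 0 by rewrite /g !mulrBr mulr1 ee ef subrr subr0.
have fg : f * g = 0 by rewrite /g !mulrBr mulr1 ff fe subr0 subrr.
have gg : g * g = g by rewrite {1}/g !mulrBl mul1r eg fg !subr0.
have efg : e + f + g = 1 by rewrite /g -addrA [f + _]addrC subrK addrC subrK.
move: g ge gf eg fg gg efg => g ge gf eg fg gg efg.
(* Maximality of the first matching: no nonzero element links idempotents [h], [m] of [gQg] with
   [h m = 0]. *)
have abg h m : h * h = h -> m * m = m -> g * h = h -> h * g = h -> g * m = m ->
    m * g = m -> h * m = 0 -> forall x, h * x * m = 0.
  move=> hh mm gh hg gm mg hm.
  have eh : e * h = 0 by rewrite -gh mulrA eg mul0r.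
  have fm : f * m = 0 by rewrite -gm mulrA fg mul0r.
  apply: max1; rewrite ?mul1r // => s t s' t' E.
  have es : e * s = 0.
    have := congr1 ( *%R e) E; rewrite !mulrDr !mulrA ee eh ef -gm mulrA eg.
    by rewrite !mul0r !addr0.
  have := congr1 ( *%R h) E; rewrite es add0r !mulrDr !mulrA hh hm -{2}hg.
  by rewrite -(mulrA h g f) gf mulr0 !mul0r !addr0.
have [a0 [b0 [e0 [f0 [[ab0 ba0 ea0 fb0] [ee0 ff0 ef0 fe0] ge0 ef0' max2]]]]] :=
  maximal_matching g e regQ injQ.
(* [e0] lies in [g Q] but perhaps not in [gQg]; [g1] generates the same right ideal and lies in
   [gQg]. Likewise [e1] replaces [f0] inside [eQe]. *)
pose g1 := e0 * g; pose e1 := f0 * e; pose z := g - g1; pose e2 := e - e1.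
have gg1 : g * g1 = g1 by rewrite /g1 mulrA ge0.
have g1g : g1 * g = g1 by rewrite /g1 -mulrA gg.
have ee1 : e * e1 = e1 by rewrite /e1 mulrA ef0'.
have e1e : e1 * e = e1 by rewrite /e1 -mulrA ee.
have g11 : g1 * g1 = g1 by rewrite {1}/g1 -mulrA gg1 /g1 mulrA ee0.
have e11 : e1 * e1 = e1 by rewrite {1}/e1 -mulrA ee1 /e1 mulrA ff0.
have gz : g * z = z by rewrite /z mulrBr gg gg1.
have zg : z * g = z by rewrite /z mulrBl gg g1g.
have g1z : g1 * z = 0 by rewrite /z mulrBr g1g g11 subrr.
have zg1 : z * g1 = 0 by rewrite /z mulrBl gg1 g11 subrr.
have zz : z * z = z by rewrite {1}/z mulrBl gz g1z subr0.
have ee2 : e * e2 = e2 by rewrite /e2 mulrBr ee ee1.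
have e1e2 : e1 * e2 = 0 by rewrite /e2 mulrBr e1e e11 subrr.
have e22 : e2 * e2 = e2 by rewrite {1}/e2 mulrBl ee2 e1e2 subr0.
(* Maximality of the second matching, applied to what is left of [g] and of [e]; the two right
   ideals are independent because [g e = 0]. *)
have ze2 x : z * x * e2 = 0.
  apply: max2 => //.
  - by rewrite /z mulrBr /g1 mulrA ee0 subrr.
  - by rewrite /e2 mulrBr /e1 mulrA ff0 subrr.
  - move=> s t s' t' /(congr1 ( *%R g)).
    by rewrite !mulrDr !mulrA ge0 gz -ef0' -ee2 !mulrA ge !mul0r addr0.
have zg1' x : z * x * g1 = 0 by exact: abg.
(* [e1] factors through [g1], so [z Q g1 = 0] gives [z Q e1 = 0]. Below, [f] factors through [e] in
   the same way. *)
have e1E : e1 = b0 * g1 * (a0 * e).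
  have -> : b0 * g1 * (a0 * e) = b0 * (e0 * (g * e0)) * a0 * e.
    by rewrite -[in LHS]ea0 /g1 !mulrA.
  by rewrite ge0 ee0 -(mulrA b0) ea0 ba0.
have ze x : z * x * e = 0.
  have -> : e = e2 + e1 by rewrite /e2 subrK.
  rewrite mulrDr ze2 add0r e1E.
  have -> : z * x * (b0 * g1 * (a0 * e)) = z * (x * b0) * g1 * (a0 * e).
    by rewrite !mulrA.
  by rewrite zg1' mul0r.
have zf x : z * x * f = 0.
  have -> : z * x * f = z * (x * b) * e * a by rewrite -ba {1}be !mulrA.
  by rewrite ze mul0r.
have one_z : 1 - z = e + f + g1.
  by rewrite -efg /z opprB addrACA subrr addr0.
clearbody z; have zC x : z * x = z * x * z.
  apply/eqP; rewrite -subr_eq0 -{1}[z * x]mulr1 -mulrBr one_z !mulrDr.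
  by rewrite ze zf zg1' !addr0.
(* [z Q (1 - z) = 0], and by regularity also [(1 - z) Q z = 0]. *)
have zcentral x : z * x = x * z.
  have z1z t : z * t * (1 - z) = 0 by rewrite mulrBr mulr1 -zC subrr.
  have := regular_zero_sym regQ z1z x; rewrite !mulrBl mul1r -zC => /eqP.
  by rewrite subr_eq0 => /eqP.
exists z; split=> // [h hh zh x|P PB PM PU x].
  have hz : h * z = h by rewrite -zcentral.
  have gh : g * h = h by rewrite -zh mulrA gz.
  have hg : h * g = h by rewrite -hz -mulrA zg.
  (* [h] and [g - h] are orthogonal idempotents of [gQg], so [abg] used both ways gives
     [h x = h x h = x h]. *)
  have hgh : h * (g - h) = 0 by rewrite mulrBr hg hh subrr.
  have ghh : (g - h) * h = 0 by rewrite mulrBl gh hh subrr.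
  have ggh : g * (g - h) = g - h by rewrite mulrBr gg gh.
  have ghg : (g - h) * g = g - h by rewrite mulrBl gg hg.
  have gh2 : (g - h) * (g - h) = g - h by rewrite {1}mulrBr ghh subr0.
  have hxg : h * x * g = h * x.
    rewrite -[in LHS]hz -(mulrA h z) zcentral !mulrA -(mulrA _ z g) zg.
    by rewrite -mulrA -zcentral mulrA hz.
  have gxh : g * x * h = x * h.
    rewrite -[in LHS]zh mulrA -(mulrA g x z) -zcentral mulrA gz.
    by rewrite zcentral -mulrA zh.
  have /eqP : h * x * (g - h) = 0 by exact: abg.
  rewrite mulrBr subr_eq0 hxg => /eqP ->.
  have /eqP : (g - h) * x * h = 0 by exact: abg.
  by rewrite !mulrBl subr_eq0 gxh => /eqP ->.
have PD u v : P u -> P v -> P (u + v).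
  move=> Pu Pv; have P0 : P 0 by rewrite -(subrr v); exact: PB.
  by rewrite -[v]opprK -[- v]sub0r; exact: PB Pu (PB _ _ P0 Pv).
have ideal := transvection_ideal PB PM PU ee.
have fE : f = (1 - e) * f by rewrite mulrBl mul1r ef subr0.
(* As [a = e a (1 - e) f], the elements [e = a b], [f = b a] and [g1], which factors through [e],
   all lie in [Q e Q (1 - e) Q]. *)
have ef1 : a = a * (1 - e) * f by rewrite -mulrA -fE.
rewrite one_z !mulrDl; apply: (PD); first apply: (PD).
- have -> : e * x = 1 * e * a * (1 - e) * (f * b * x).
    by rewrite mul1r ea !mulrA -ef1 ab.
  exact: ideal.
- have -> : f * x = b * e * a * (1 - e) * (f * x).
    by rewrite -[in LHS]ba {1}ef1 -[a in LHS]ea !mulrA.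
  exact: ideal.
have -> : g1 * x = a0 * e * a * (1 - e) * (f * b * b0 * g * x).
  have a0E : a0 = a0 * e * f0 by rewrite -mulrA ef0' -ba0 mulrA ab0 ea0.
  rewrite !mulrA -(mulrA (a0 * e) a) -(mulrA (a0 * e) (a * _)) -ef1.
  rewrite -[a0 * e * a * b]mulrA ab -[a0 * e * e]mulrA ee.
  by rewrite /g1 -ab0 {1}a0E -!mulrA (mulrA f0) fb0.
exact: ideal.
Qed.

End SelfInjective.

(** The equation [a a b = a] excludes nonzero elements of square zero, such as [e x (1 - e)] and
    [(1 - e) x e]. *)
Lemma strongly_regular_abelian (B : pzRingType) :
  (forall a : B, exists b, a * b * a = a /\ a * a * b = a) -> abelian_regular B.
Proof.
move=> sreg; split=> [a|e ee x]; first by have [b []] := sreg a; exists b.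
have reduced (a : B) : a * a = 0 -> a = 0.
  by move=> aa; have [b [_]] := sreg a; rewrite aa mul0r.
have ee' : e * (1 - e) = 0 by rewrite mulrBr mulr1 ee subrr.
have e'e : (1 - e) * e = 0 by rewrite mulrBl mul1r ee subrr.
have /eqP : e * x * (1 - e) = 0.
  by apply: reduced; rewrite -!mulrA (mulrA (1 - e)) e'e mul0r !mulr0.
rewrite mulrBr mulr1 subr_eq0 => /eqP ->.
have /eqP : (1 - e) * x * e = 0.
  by apply: reduced; rewrite -!mulrA (mulrA e (1 - e)) ee' mul0r !mulr0.
by rewrite -mulrA mulrBl mul1r subr_eq0 mulrA => /eqP.
Qed.

(* The unit is [y + (1 - x y)], where [y] is a quasi-inverse of [x]. *)
Lemma central_regular_unit (Q : pzRingType) (z x : Q) :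
    von_neumann_regular Q -> (forall y, z * y = y * z) ->
    (forall h, h * h = h -> z * h = h -> forall y, h * y = y * h) -> z * x = x ->
  exists u v, [/\ u * v = 1, v * u = 1, x * u * x = x & x * x * u = x].
Proof.
move=> regQ zC idC zx; have [y xyx yxy] := regular_inverse regQ x.
have xz : x * z = x by rewrite -zC.
have zy : z * y = y by rewrite -yxy !mulrA zC -!mulrA (mulrA z) zx.
have ixy : (x * y) * (x * y) = x * y by rewrite mulrA xyx.
have iyx : (y * x) * (y * x) = y * x by rewrite mulrA yxy.
have cxy := idC (x * y) ixy (etrans (mulrA _ _ _) (congr1 ( *%R^~ y) zx)).
have cyx := idC (y * x) iyx (etrans (mulrA _ _ _) (congr1 ( *%R^~ x) zy)).
have xyC : x * y = y * x.
  have -> : x * y = (y * x) * (x * y) by rewrite mulrA cyx !mulrA xyx.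
  by rewrite -(cxy (y * x)) mulrA cxy !mulrA yxy.
have xxy : x * x * y = x by rewrite -mulrA xyC mulrA xyx.
have xe : x * (1 - x * y) = 0 by rewrite mulrBr mulr1 mulrA xxy subrr.
have ex : (1 - x * y) * x = 0 by rewrite mulrBl mul1r xyx subrr.
have ye : y * (1 - x * y) = 0 by rewrite mulrBr mulr1 mulrA yxy subrr.
have ey : (1 - x * y) * y = 0 by rewrite mulrBl mul1r xyC yxy subrr.
have ee : (1 - x * y) * (1 - x * y) = 1 - x * y.
  by rewrite {1}mulrBl mul1r -mulrA ye mulr0 subr0.
move: (1 - x * y) (subrKC (x * y) 1) xe ex ye ey ee => e e1 xe ex ye ey ee.
exists (y + e), (x + e).
split; rewrite ?mulrDr ?mulrDl ?xe ?ex ?ye ?ey ?ee ?add0r ?addr0 -?xyC ?xyx //.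
  by rewrite mul0r addr0.
by rewrite xxy -mulrA xe mulr0 addr0.
Qed.

(** * Change of rings *)

Section LinearMaps.
Variable S : pzRingType.

Lemma linear_of_fun (V W : lmodType S) (f : V -> W) :
  linear f -> exists g : {linear V -> W}, g =1 f.
Proof.
move=> lf; pose g : {linear V -> W} := HB.pack f (GRing.isLinear.Build _ _ _ _ f lf).
by exists g.
Qed.

Lemma linear_inverse (V W : lmodType S) (f : {linear V -> W}) :
  bijective f -> exists g : {linear W -> V}, cancel f g /\ cancel g f.
Proof.
case=> g0 fK gK; have [|g gE] := @linear_of_fun W V g0.
  by move=> a x y; apply: (can_inj fK); rewrite linearP !gK.
by exists g; split=> x; rewrite gE ?fK ?gK.
Qed.

Lemma corestriction (V W : lmodType S) (K : submod W) (f : {linear V -> W}) :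
    (forall v, submod_set K (f v)) ->
  exists g : {linear V -> submod_type K}, forall v, val (g v) = f v.
Proof.
move=> Kf; have Kf' v : f v \in submod_pred K by exact/submod_predP.
have [a x y|g gE] := @linear_of_fun V (submod_type K) (fun v => Sub (f v) (Kf' v)).
  by apply: val_inj; rewrite [RHS]linearP !SubK linearP.
by exists g => v; rewrite gE SubK.
Qed.

End LinearMaps.

Section RestrictionOfScalars.
Definition restrict_scalars (A B : pzRingType) (rho : {rmorphism A -> B})
  (U : lmodType B) : Type := U.

Variables (A B : pzRingType) (rho : {rmorphism A -> B}) (U : lmodType B).
Local Notation V := (restrict_scalars rho U).

HB.instance Definition _ := GRing.Zmodule.copy V U.

Definition restrict_scale (a : A) (u : V) : V := rho a *: (u : U).

Fact restrict_scaleA a b u :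
  restrict_scale a (restrict_scale b u) = restrict_scale (a * b) u.
Proof. by rewrite /restrict_scale scalerA rmorphM. Qed.
Fact restrict_scale1 : left_id 1 restrict_scale.
Proof. by move=> u; rewrite /restrict_scale rmorph1 scale1r. Qed.
Fact restrict_scaleDr : right_distributive restrict_scale +%R.
Proof. by move=> a u v; exact: scalerDr. Qed.
Fact restrict_scaleDl u : {morph restrict_scale^~ u : a b / a + b}.
Proof. by move=> a b; rewrite /restrict_scale rmorphD; exact: scalerDl. Qed.

HB.instance Definition _ := GRing.Zmodule_isLmodule.Build A V
  restrict_scaleA restrict_scale1 restrict_scaleDr restrict_scaleDl.

End RestrictionOfScalars.

(** [sigma] identifies [B] with the ideal [z Q], where [z = sigma 1] is central. Multiplication by
    [z] gives a ring morphism from [Q] onto [B]; along it [B]-modules become [Q]-modules, and an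
    extension found over [Q] is composed with it to return to [B]. *)
Lemma central_corner_self_injective (Q B : pzRingType) (sigma : B -> Q) :
    {morph sigma : x y / x + y} -> {morph sigma : x y / x * y} ->
    injective sigma -> (forall x, sigma 1 * x = x * sigma 1) ->
    (forall x, exists b, sigma b = sigma 1 * x) ->
    von_neumann_regular Q -> right_self_injective Q ->
  von_neumann_regular B /\ right_self_injective B.
Proof.
move=> sD sM sI zC sS regQ injQ; set z := sigma 1 in zC sS.
have zs b : z * sigma b = sigma b by rewrite -sM mul1r.
have s0 : sigma 0 = 0 by apply: (addrI (sigma 0)); rewrite -sD !addr0.
have [rho0 rhoE] := choice sS.
have rho0K : cancel sigma rho0 by move=> b; apply: sI; rewrite rhoE zs.
split=> [b|].
  have [y yE] := regQ (sigma b); exists (rho0 y); apply: sI.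
  by rewrite !sM rhoE mulrA -zC zs yE.
have rhoB : zmod_morphism (rho0 : Q^c -> B^c).
  move=> x y; apply: sI; have sN b : sigma (- b) = - sigma b.
    by apply: (addrI (sigma b)); rewrite -sD !subrr s0.
  by rewrite sD sN !rhoE mulrBr.
have rhoM : monoid_morphism (rho0 : Q^c -> B^c).
  split=> [|x y]; apply: sI; first by rewrite rhoE mulr1.
  rewrite [RHS]sM !rhoE.
  have -> : z * (y : Q) * (z * (x : Q)) = z * z * ((y : Q) * (x : Q)).
    by rewrite !mulrA -(mulrA z (y : Q)) -zC !mulrA.
  by rewrite -[z * z]sM mul1r.
pose rho : {rmorphism Q^c -> B^c} := HB.pack (rho0 : Q^c -> B^c)
  (GRing.isZmodMorphism.Build Q^c B^c rho0 rhoB)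
  (GRing.isMonoidMorphism.Build Q^c B^c rho0 rhoM).
have rhoK : cancel sigma rho by [].
move=> U V i f inj_i.
pose Ur : rmodType Q := restrict_scalars rho U.
pose Vr : rmodType Q := restrict_scalars rho V.
have [|ir irE] := @linear_of_fun Q^c Ur Vr i.
  by move=> a u v; rewrite [LHS]linearP.
have [|fr frE] := @linear_of_fun Q^c Ur (Q^c^o : rmodType Q) (sigma \o f).
  move=> a u v /=; rewrite linearP sD; congr (_ + _).
  by rewrite [LHS]sM rhoE mulrA -zC zs.
have [|g gE] := injQ Ur Vr ir fr; first by move=> u v; rewrite !irE => /inj_i.
have [|gr grE] := @linear_of_fun B^c V (B^c^o : rmodType B) (rho \o g).
  move=> b u v /=.
  have -> : b *: u + v = (sigma b : Q^c) *: (u : Vr) + v.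
    by rewrite [in RHS]/GRing.scale /= /restrict_scale rhoK.
  rewrite linearP [LHS](rmorphD rho); congr (_ + _).
  by rewrite [LHS](rmorphM rho) rhoK.
exists gr => u /=; rewrite grE /= -irE.
by have /= -> := gE u; rewrite frE; exact: rhoK.
Qed.

(** * Direct sums and corners of endomorphism rings *)

Section JacobsonUnits.
Variable A : pzRingType.
Implicit Types x y : A.

(** Both [x y] and [y x] are 1 minus a radical element, hence invertible; the resulting right and
    left inverses of [x] agree. *)
Lemma jacobson_lift_unit x y :
    1 - x * y \in jacobson A -> 1 - y * x \in jacobson A ->
  exists w, x * w = 1 /\ w * x = 1.
Proof.
move=> /jacobson_inv[u []]; rewrite opprB addrC subrK => xyu _.
move=> /jacobson_inv[v []]; rewrite opprB addrC subrK => _ vyx.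
exists (y * u); split; first by rewrite mulrA.
suff -> : y * u = v * y by rewrite -mulrA.
by rewrite -[y * u]mul1r -vyx -!mulrA (mulrA x) xyu mulr1.
Qed.

End JacobsonUnits.

HB.instance Definition _ (S : pzRingType) (U : lmodType S) (f : endo U) :=
  GRing.Linear.copy (endo_app f) (f : {linear U -> U}).

Lemma endo_mulE (S : pzRingType) (U : lmodType S) (f g : endo U) x :
  endo_app (f * g) x = endo_app f (endo_app g x).
Proof. by []. Qed.

Lemma endo_addE (S : pzRingType) (U : lmodType S) (f g : endo U) x :
  endo_app (f + g) x = endo_app f x + endo_app g x.
Proof. by []. Qed.

Lemma endo_subE (S : pzRingType) (U : lmodType S) (f g : endo U) x :
  endo_app (f - g) x = endo_app f x - endo_app g x.
Proof. by []. Qed.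

Section Corner.
Variables (S : pzRingType) (M N : lmodType S).
Variables (i : {linear N -> M}) (q : {linear M -> N}).
Hypothesis iK : cancel i q.
Implicit Types (n : endo N) (s t : endo M).

(** [expand] identifies End(N) with the corner [f End(M) f], sending 1 to [f]. Its left inverse
    [compress] is multiplicative across an inserted [f]. *)
Definition expand n : endo M := (i \o endo_app n \o q : {linear M -> M}).
Definition compress s : endo N := (q \o endo_app s \o i : {linear N -> N}).
Definition corner_idem : endo M := (i \o q : {linear M -> M}).

Local Notation f := corner_idem.

Lemma expandE n x : endo_app (expand n) x = i (endo_app n (q x)).
Proof. by []. Qed.

Lemma compressE s x : endo_app (compress s) x = q (endo_app s (i x)).
Proof. by []. Qed.

Lemma corner_idemE x : endo_app corner_idem x = i (q x).
Proof. by []. Qed.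

Lemma expandB : {morph expand : n m / n - m}.
Proof. by move=> n m; apply: endoP => x; exact: raddfB. Qed.

Lemma expandD : {morph expand : n m / n + m}.
Proof. by move=> n m; apply: endoP => x; exact: raddfD. Qed.

Lemma compressB : {morph compress : s t / s - t}.
Proof. by move=> s t; apply: endoP => x; exact: raddfB. Qed.

Lemma compressD : {morph compress : s t / s + t}.
Proof. by move=> s t; apply: endoP => x; exact: raddfD. Qed.

Lemma expandM : {morph expand : n m / n * m}.
Proof.
move=> n m; apply: endoP => x; by rewrite endo_mulE !expandE iK.
Qed.

Lemma expand1 : expand 1 = f.
Proof. exact: endoP. Qed.

Lemma compress1 : compress 1 = 1.
Proof. by apply: endoP => x; exact: iK. Qed.

Lemma expandK : cancel expand compress.
Proof.
move=> n; apply: endoP => x.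
by rewrite compressE expandE !iK.
Qed.

Lemma expand_compress s : expand (compress s) = f * s * f.
Proof. exact: endoP. Qed.

Lemma compress_corner s t : compress (s * f * t) = compress s * compress t.
Proof. exact: endoP. Qed.

Lemma corner_idemM : f * f = f.
Proof. by rewrite -expand1 -expandM mulr1. Qed.

Lemma corner_expand n : f * expand n = expand n.
Proof. by rewrite -expand1 -expandM mul1r. Qed.

Lemma expand_corner n : expand n * f = expand n.
Proof. by rewrite -expand1 -expandM mulr1. Qed.

Lemma compress_cornerl s : compress (f * s) = compress s.
Proof. by rewrite -[f * s]mul1r mulrA compress_corner compress1 mul1r. Qed.

Lemma compress_expandl n s : compress (expand n * s) = n * compress s.
Proof. by rewrite -expand_corner compress_corner expandK. Qed.

Lemma compress_expandr s n : compress (s * expand n) = compress s * n.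
Proof. by rewrite -corner_expand mulrA compress_corner expandK. Qed.

Lemma expand_sandwich n s m : expand n * s * expand m = expand (n * compress s * m).
Proof. exact: endoP. Qed.

(** A right inverse of [1 - s (expand n)] compresses to one of [1 - (compress s) n], because
    [compress] kills [(1 - f) t]. *)
Lemma compress_jacobson s : s \in jacobson (endo M) -> compress s \in jacobson (endo N).
Proof.
move=> Js; apply: jacobson_rinvP => n.
have [t st1] := jacobson_rinv (jacobsonMr (expand n) Js); exists (compress t).
rewrite -compress_expandr -{1}compress1 -compressB -compress_corner.
suff -> : (1 - s * expand n) * f * t = 1 - (1 - f) * t.
  by rewrite compressB mulrBl mul1r compressB compress_cornerl subrr subr0 compress1.
have snf : s * expand n * f = s * expand n by rewrite -mulrA expand_corner.
rewrite -[X in _ = X - _]st1 !mulrBl snf !mul1r opprB.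
by rewrite [RHS]addrC addrA subrK.
Qed.

Lemma expand_jacobson n : n \in jacobson (endo N) -> expand n \in jacobson (endo M).
Proof.
move=> Jn; apply: jacobson_rinvP => s.
have [c nc1] := jacobson_rinv (jacobsonMr (compress s) Jn).
(* This is the formula [1 + a (1 - b a)^-1 b] for an inverse of [1 - a b], with [a = i] and
   [b = n q s]. *)
exists (1 + expand (c * n) * s).
rewrite mulrBl mul1r mulrDr mulr1 mulrA expand_sandwich opprD addrACA -mulrBl.
rewrite -expandB (mulrA _ c) -mulrBl -{1}[c]mul1r -mulrBl nc1 mul1r.
by rewrite subrK.
Qed.

Lemma expand_jacobsonE n : (expand n \in jacobson (endo M)) = (n \in jacobson (endo N)).
Proof.
apply/idP/idP => [/compress_jacobson|]; last exact: expand_jacobson.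
by rewrite expandK.
Qed.

(* [1 - s (1 - f)] is a unit [u]; conjugating by it moves [s] to an idempotent
   fixed by right multiplication by [f]. *)
Lemma corner_idempotent_lift n s :
    s * s = s -> s - expand n \in jacobson (endo M) ->
  exists2 e, e * e = e & e - n \in jacobson (endo N).
Proof.
move=> ss Jsn; pose r := s * (1 - f).
have Jr : r \in jacobson (endo M).
  have -> : r = (s - expand n) * (1 - f).
    by rewrite mulrBl [X in _ - X]mulrBr mulr1 expand_corner subrr subr0.
  exact: jacobsonMr.
have [v [uv vu]] := jacobson_inv Jr.
have sr : s * (1 - r) = s * f.
  by rewrite /r mulrBr mulr1 mulrA ss mulrBr mulr1 subKr.
clearbody r; pose e1 := v * s * (1 - r).
have e1E : e1 = v * s * f by rewrite /e1 -mulrA sr mulrA.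
have e1f : e1 * f = e1 by rewrite e1E -!mulrA corner_idemM.
have e11 : e1 * e1 = e1.
  by rewrite /e1 !mulrA -(mulrA (v * s) _ v) uv mulr1 -(mulrA v s s) ss.
have Je1 : e1 - s \in jacobson (endo M).
  have -> : e1 - s = v * (r * s - s * r).
    rewrite -[s in LHS]mul1r -vu /e1 -!mulrA -mulrBr; congr (v * _).
    by rewrite mulrBr mulrBl mulr1 mul1r opprB addrC addrA subrK.
  by apply: jacobsonMl; apply: rpredB; [exact: jacobsonMr | exact: jacobsonMl].
exists (compress e1); first by rewrite -compress_corner e1f e11.
rewrite -[n]expandK -compressB; apply: compress_jacobson.
by rewrite -(subrK s e1) -addrA; exact: rpredD.
Qed.

End Corner.

(** The image of an idempotent is realised as its submodule of fixed points. The image of [f] is the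
    second summand, since it will serve as [L]. *)
Lemma idempotent_direct_sum (S : pzRingType) (M : lmodType S) (f : endo M) :
    f * f = f ->
  exists (N L : lmodType S) (D : direct_sum M N L),
    corner_idem (dsum_inj2 D) (dsum_proj2 D) = f.
Proof.
have img (g : endo M) : g * g = g ->
    exists (N : lmodType S) (i : {linear N -> M}) (q : {linear M -> N}),
      cancel i q /\ corner_idem i q = g.
  move=> gg; pose K : set M := [set x | endo_app g x = x]%classic.
  have sK : submodule K.
    split=> [|x y Kx Ky|a x Kx]; rewrite /K /= ?raddf0 //.
      by rewrite raddfD; exact: (congr2 +%R Kx Ky).
    by rewrite linearZ_LR; exact: (congr1 ( *:%R a) Kx).
  have [x|q qE] := @corestriction S M M (Submod sK) (endo_app g).
    by rewrite /= /K /= -endo_mulE gg.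
  exists (submod_type (Submod sK)), (val : {linear submod_type (Submod sK) -> M}), q.
  split; last by apply: endoP => x; exact: qE.
  move=> x; apply: val_inj; rewrite qE.
  exact: elimT (submod_predP (Submod sK) _) (valP x).
move=> ff; have [|N [i1 [q1 [iK1 iq1]]]] := img (1 - f).
  by rewrite mulrBr mulr1 mulrBl mul1r ff subrr subr0.
have [L [i2 [q2 [iK2 iq2]]]] := img f ff.
exists N, L.
have D12 y : q1 (i2 y) = 0.
  have : endo_app (corner_idem i1 q1 * corner_idem i2 q2) (i2 y) = 0.
    by rewrite iq1 iq2 mulrBl mul1r ff subrr.
  by rewrite endo_mulE !corner_idemE iK2 => /(congr1 q1); rewrite iK1 raddf0.
have D21 x : q2 (i1 x) = 0.
  have : endo_app (corner_idem i2 q2 * corner_idem i1 q1) (i1 x) = 0.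
    by rewrite iq1 iq2 mulrBr mulr1 ff subrr.
  by rewrite endo_mulE !corner_idemE iK1 => /(congr1 q2); rewrite iK2 raddf0.
have DD z : i1 (q1 z) + i2 (q2 z) = z.
  have : endo_app (corner_idem i1 q1 + corner_idem i2 q2) z = z.
    by rewrite iq1 iq2 subrK.
  by [].
by exists (DirectSum iK1 iK2 D12 D21 DD).
Qed.

(** An isomorphism of [N1] onto [N2] yields [t] with [t t = 0], which is radical because abelian
    regular rings are reduced. Then [s t], the projection onto [N1], is a radical idempotent, hence
    0. *)
Lemma abelian_regular_square_free (S : pzRingType) (N : lmodType S) :
  abelian_regular (quotJ (endo N)) -> square_free N.
Proof.
move=> [reg ab] [N1 [N2 [N3 [[phi bphi] [theta btheta] [x x0]]]]].
have [psi [phiK psiK]] := linear_inverse bphi.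
have [eta [thetaK etaK]] := linear_inverse btheta.
have [|i1 i1E] := @linear_of_fun S N1 N (fun x => phi (x, 0, 0)).
  move=> a u v; rewrite -linearP; congr (phi _).
  by congr (_, _, _); rewrite /= scaler0 addr0.
have [|i2 i2E] := @linear_of_fun S N2 N (fun y => phi (0, y, 0)).
  move=> a u v; rewrite -linearP; congr (phi _).
  by congr (_, _, _); rewrite /= scaler0 addr0.
have [|q1 q1E] := @linear_of_fun S N N1 (fun n => (psi n).1.1).
  by move=> a u v; rewrite linearP.
have [|q2 q2E] := @linear_of_fun S N N2 (fun n => (psi n).1.2).
  by move=> a u v; rewrite linearP.
have iK1 y : q1 (i1 y) = y by rewrite q1E i1E phiK.
have iK2 y : q2 (i2 y) = y by rewrite q2E i2E phiK.
have i12 y : q1 (i2 y) = 0 by rewrite q1E i2E phiK.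
pose t : endo N := (i2 \o theta \o q1 : {linear N -> N}).
pose s : endo N := (i1 \o eta \o q2 : {linear N -> N}).
have tE y : endo_app t y = i2 (theta (q1 y)) by [].
have sE y : endo_app s y = i1 (eta (q2 y)) by [].
have tt : t * t = 0.
  by apply: endoP => y; rewrite endo_mulE !tE i12 !raddf0.
have stst : (s * t) * (s * t) = s * t.
  by apply: endoP => y; rewrite !endo_mulE !tE !sE iK1 iK2 !thetaK.
have Jt : t \in jacobson (endo N).
  apply/quotJ_eq0; have [y tyt] := reg (t%:J).
  have ity : (t%:J * y) * (t%:J * y) = t%:J * y by rewrite mulrA tyt.
  by rewrite -tyt ab // mulrA -quotJ_piM tt quotJ_pi0 mul0r.
have st0 := jacobson_idem (jacobsonMl s Jt) stst.
have : endo_app (s * t) (i1 (eta x)) = 0 by rewrite st0.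
rewrite endo_mulE tE sE iK1 iK2 thetaK => /(congr1 q1).
by rewrite iK1 raddf0 => /(congr1 theta); rewrite etaK raddf0 => /eqP; exact/negP.
Qed.

Section DirectSumQuotient.
Variables (S : pzRingType) (M N L : lmodType S) (D : direct_sum M N L).
Local Notation c1 := (compress (dsum_inj1 D) (dsum_proj1 D)).
Local Notation c2 := (compress (dsum_inj2 D) (dsum_proj2 D)).
Local Notation f1 := (corner_idem (dsum_inj1 D) (dsum_proj1 D)).
Local Notation f2 := (corner_idem (dsum_inj2 D) (dsum_proj2 D)).

Lemma corner_idemD : f1 + f2 = 1.
Proof. by apply: endoP => x; exact: dsum_inj_proj. Qed.

Lemma hom12_endoP s : exists f : {linear N -> L}, f2 * s * f1 = hom12_endo D f.
Proof.
exists (dsum_proj2 D \o endo_app s \o dsum_inj1 D : {linear N -> L}); exact: endoP.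
Qed.

Lemma hom21_endoP s : exists f : {linear L -> N}, f1 * s * f2 = hom21_endo D f.
Proof.
exists (dsum_proj1 D \o endo_app s \o dsum_inj2 D : {linear L -> N}); exact: endoP.
Qed.

Lemma hom12_endo_corner f : f2 * hom12_endo D f * f1 = hom12_endo D f.
Proof.
apply: endoP => x; rewrite !endo_mulE.
by rewrite /hom12_endo /corner_idem /endo_app /= dsum_proj1_inj1 dsum_proj2_inj2.
Qed.

Lemma hom21_endo_corner f : f1 * hom21_endo D f * f2 = hom21_endo D f.
Proof.
apply: endoP => x; rewrite !endo_mulE.
by rewrite /hom21_endo /corner_idem /endo_app /= dsum_proj1_inj1 dsum_proj2_inj2.
Qed.

(** Modulo the radical every endomorphism of [M] is block diagonal, so compression to the two blocks
    becomes multiplicative and bijective. *)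
Lemma quotJ_direct_sum :
    (forall f : {linear N -> L}, hom12_endo D f \in jacobson (endo M)) ->
    (forall f : {linear L -> N}, hom21_endo D f \in jacobson (endo M)) ->
  ring_iso (quotJ (endo M)) (quotJ (endo N) * quotJ (endo L))%type.
Proof.
move=> J12 J21.
have J21' s : f2 * s * f1 \in jacobson (endo M) by have [f ->] := hom12_endoP s.
have J12' s : f1 * s * f2 \in jacobson (endo M) by have [f ->] := hom21_endoP s.
have K1 := dsum_proj1_inj1 D; have K2 := dsum_proj2_inj2 D.
pose F (x : quotJ (endo M)) : quotJ (endo N) * quotJ (endo L) :=
  ((c1 (repr x))%:J, (c2 (repr x))%:J).
have FE s : F (s%:J) = ((c1 s)%:J, (c2 s)%:J).
  have Js : repr (s%:J) - s \in jacobson (endo M) by apply/quotJ_eq; rewrite reprK.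
  by congr (_, _); apply/quotJ_eq; rewrite -compressB; exact: compress_jacobson.
have FB : zmod_morphism F.
  move=> x y; have [s <-] := quotJ_surj x; have [t <-] := quotJ_surj y.
  by rewrite -quotJ_piB !FE !compressB !quotJ_piB.
have FM : monoid_morphism F.
  split=> [|x y]; first by rewrite -quotJ_pi1 FE !compress1 // !quotJ_pi1.
  have [s <-] := quotJ_surj x; have [t <-] := quotJ_surj y.
  rewrite -quotJ_piM !FE -[RHS]/(_ * _, _ * _) -!quotJ_piM.
  rewrite -!compress_corner; congr (_, _); apply/quotJ_eq; rewrite -compressB.
    have -> : s * t - s * f1 * t = s * f2 * t.
      by rewrite -mulrBl -{1}[s]mulr1 -mulrBr -corner_idemD addrC addKr.
    rewrite -(compress_cornerl K1) mulrA; apply: compress_jacobson => //.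
    by rewrite mulrA; exact: jacobsonMr.
  have -> : s * t - s * f2 * t = s * f1 * t.
    by rewrite -mulrBl -{1}[s]mulr1 -mulrBr -corner_idemD addrK.
  rewrite -(compress_cornerl K2) mulrA; apply: compress_jacobson => //.
  by rewrite mulrA; exact: jacobsonMr.
pose F' : {rmorphism quotJ (endo M) -> (quotJ (endo N) * quotJ (endo L))%type} :=
  HB.pack F (GRing.isZmodMorphism.Build _ _ F FB)
    (GRing.isMonoidMorphism.Build _ _ F FM).
exists F'.
pose G (y : quotJ (endo N) * quotJ (endo L)) : quotJ (endo M) :=
  (expand (dsum_inj1 D) (dsum_proj1 D) (repr y.1) +
   expand (dsum_inj2 D) (dsum_proj2 D) (repr y.2))%:J.
exists G => [x|[y1 y2]] /=.
  have [s <-] := quotJ_surj x; rewrite FE /G /=; apply/quotJ_eq.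
  set a := repr _; set b := repr _.
  have Ja : a - c1 s \in jacobson (endo N) by apply/quotJ_eq; rewrite reprK.
  have Jb : b - c2 s \in jacobson (endo L) by apply/quotJ_eq; rewrite reprK.
  have sE : s = f1 * s * f1 + f2 * s * f2 + (f2 * s * f1 + f1 * s * f2).
    transitivity ((f1 + f2) * s * (f1 + f2)).
      by rewrite corner_idemD mul1r mulr1.
    by rewrite mulrDl mulrDr !mulrDl [X in _ + X]addrC addrACA.
  set E1 := expand _ _ a; set E2 := expand _ _ b.
  have -> : E1 + E2 - s = expand (dsum_inj1 D) (dsum_proj1 D) (a - c1 s) +
      expand (dsum_inj2 D) (dsum_proj2 D) (b - c2 s) -
      (f2 * s * f1 + f1 * s * f2).
    rewrite [X in _ - X]sE !expandB !expand_compress opprD addrA.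
    by congr (_ - _); rewrite opprD addrACA.
  by apply: rpredB; apply: rpredD => //; exact: expand_jacobson.
rewrite -[LHS]/(F (G (y1, y2))) FE !compressD !expandK //=.
have -> b : c1 (expand (dsum_inj2 D) (dsum_proj2 D) b) = 0.
  by apply: endoP => x; exact: dsum_proj1_inj2.
have -> b : c2 (expand (dsum_inj1 D) (dsum_proj1 D) b) = 0.
  by apply: endoP => x; exact: dsum_proj2_inj1.
by rewrite addr0 add0r !reprK.
Qed.

End DirectSumQuotient.

(** * Endomorphisms descending along a cover *)

(** Coinvariance provides some cover of [M]. Covers are unique up to an isomorphism [a] over [M],
    and conjugation by [a] transfers the property to [p]. *)
Lemma cover_automorphism_descends (S : pzRingType) (cX : lmodType S -> Prop)
    (X M : lmodType S) (p : {linear X -> M}) :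
    X_cover cX p -> X_automorphism_coinvariant cX M ->
  forall g : {linear X -> X}, bijective g ->
    exists f : {linear M -> M}, f \o p =1 p \o g.
Proof.
move=> [[cXX preX] minX] [X' [p' [[[cXX' preX'] minX'] autX']]] g bij_g.
have [a aE] := preX' X p cXX; have [b bE] := preX X' p' cXX'.
have [|u uK uK'] := minX (b \o a : {linear X -> X}).
  by move=> x /=; rewrite [p _]bE [p' _]aE.
have [|v vK vK'] := minX' (a \o b : {linear X' -> X'}).
  by move=> x /=; rewrite [p' _]aE [p _]bE.
have bij_a : bijective a.
  exists (u \o b) => x /=; first exact: uK.
  rewrite -[x]vK' /=; congr (a _).
  exact: uK.
have [c [aK cK]] := linear_inverse bij_a.
have bij_g' : bijective (a \o g \o c : {linear X' -> X'}).
  have [d [gK dK]] := linear_inverse bij_g.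
  by exists (a \o d \o c) => x /=; rewrite aK ?gK ?dK cK.
have [f fE] := autX' _ bij_g'; exists f => x /=.
rewrite -[p x]aE [LHS]fE /= aK; exact: aE.
Qed.

(** A relation, not a map: for a cover that is epimorphic, [g] determines [s], while [s] determines
    [g] only modulo the radical, and not every [g] need descend. *)
Definition lies_over (S : pzRingType) (X M : lmodType S) (p : {linear X -> M})
    (s : endo M) (g : endo X) : Prop :=
  forall x, endo_app s (p x) = p (endo_app g x).

(** * Lifting and descent modulo the radicals *)

Section AutomorphismDescent.
Variables (S : pzRingType) (X M : lmodType S) (p : {linear X -> M}).
Hypothesis epi_p : epimorphic p.
Hypothesis lift_p : forall s, exists g, lies_over p s g.
Hypothesis min_p :
  forall h : endo X, (forall x, p (endo_app h x) = p x) ->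
    exists w, h * w = 1 /\ w * h = 1.
Hypothesis aut_p :
  forall g w : endo X, g * w = 1 -> w * g = 1 -> exists s, lies_over p s g.
Implicit Types (s t : endo M) (g h : endo X).
Local Notation over := (lies_over p).

Lemma over1 : over 1 1. Proof. by []. Qed.

Lemma overB s t g h : over s g -> over t h -> over (s - t) (g - h).
Proof.
move=> sg th x.
by rewrite !endo_subE sg th raddfB.
Qed.

Lemma overD s t g h : over s g -> over t h -> over (s + t) (g + h).
Proof.
by move=> sg th x; rewrite !endo_addE sg th raddfD.
Qed.

Lemma overM s t g h : over s g -> over t h -> over (s * t) (g * h).
Proof. by move=> sg th x; rewrite !endo_mulE th sg. Qed.

Lemma over_inj s t g : over s g -> over t g -> s = t.
Proof.
by move=> sg tg; apply: endoP => m; have [x <-] := epi_p m; rewrite sg tg.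
Qed.

(** [p (g - h) = 0], so [p] is unchanged by [1 - (g - h) r], which minimality makes invertible. *)
Lemma over_jacobson_unique s g h : over s g -> over s h -> g - h \in jacobson (endo X).
Proof.
move=> sg sh; apply: jacobson_rinvP => r.
have [x|w [hw _]] := @min_p (1 - (g - h) * r); last by exists w.
by rewrite endo_subE endo_mulE endo_subE !raddfB /= -sg -sh subrr addr0.
Qed.

(** The unit [1 - g] descends, hence so does [g]. If [c] lifts [r], the inverse of [1 - g c]
    descends to a right inverse of [1 - s r]. *)
Lemma jacobson_descends g :
  g \in jacobson (endo X) -> exists2 s, over s g & s \in jacobson (endo M).
Proof.
move=> Jg; have [w [gw wg]] := jacobson_inv Jg.
have [t tg] := aut_p gw wg; have sg : over (1 - t) g.
  by have := overB over1 tg; rewrite subKr.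
exists (1 - t) => //; apply: jacobson_rinvP => r.
have [c rc] := lift_p r; have [v [gv vg]] := jacobson_inv (jacobsonMr c Jg).
have [u uv] := aut_p vg gv; exists u.
by apply: (over_inj (overM (overB over1 (overM sg rc)) uv)); rewrite gv; exact: over1.
Qed.

Lemma over_jacobson s g : over s g -> g \in jacobson (endo X) -> s \in jacobson (endo M).
Proof.
by move=> sg /jacobson_descends[t tg Jt]; rewrite (over_inj sg tg).
Qed.

Lemma descends_coset s g h :
  over s g -> h - g \in jacobson (endo X) -> exists t, over t h.
Proof.
move=> sg /jacobson_descends[r rhg _]; exists (r + s).
by have := overD rhg sg; rewrite subrK.
Qed.

Lemma unit_descends (x y : quotJ (endo X)) :
  x * y = 1 -> y * x = 1 -> exists s g, over s g /\ g%:J = x.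
Proof.
have [g <-] := quotJ_surj x; have [h <-] := quotJ_surj y.
rewrite -!quotJ_piM -!quotJ_pi1 => /esym/quotJ_eq Jgh /esym/quotJ_eq Jhg.
have [w [gw wg]] := jacobson_lift_unit Jgh Jhg.
by have [s sg] := aut_p gw wg; exists s, g.
Qed.

(** * The two summands cut out by a central idempotent *)

Section CentralIdempotent.
Variables (z : quotJ (endo X)) (gL : endo X) (f : endo M).
Hypothesis zz : z * z = z.
Hypothesis zC : forall x, z * x = x * z.
Hypothesis gLz : gL%:J = 1 - z.
Hypothesis fgL : over f gL.
Hypothesis descz : forall g, (1 - z) * g%:J = g%:J -> exists s, over s g.

Lemma compl_idem : (1 - z) * (1 - z) = 1 - z.
Proof. by rewrite mulrBr mulr1 mulrBl mul1r zz subrr subr0. Qed.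

Lemma compl_central x : (1 - z) * x = x * (1 - z).
Proof. by rewrite mulrBl mulrBr mul1r mulr1 zC. Qed.

Lemma over_compl s g : f * s = s -> over s g -> (1 - z) * g%:J = g%:J.
Proof.
move=> fs sg; rewrite -gLz -quotJ_piM; apply/quotJ_eq.
by apply: (over_jacobson_unique _ sg); rewrite -fs; exact: overM.
Qed.

(** Modulo the radical [g] equals [g gL], and [gL r] descends, so a right inverse on [M] lifts to
    some [c] with [(1 - g r) c] congruent to 1. *)
Lemma over_jacobson_reflect s g :
    (1 - z) * g%:J = g%:J -> over s g -> s \in jacobson (endo M) ->
  g \in jacobson (endo X).
Proof.
move=> zg sg Js; apply: jacobson_rinvP => r.
have [|s' s'r] := @descz (gL * r).
  by rewrite quotJ_piM mulrA gLz compl_idem.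
have [t st1] := jacobson_rinv (jacobsonMr s' Js); have [c tc] := lift_p t.
have J1 : 1 - (1 - g * (gL * r)) * c \in jacobson (endo X).
  apply: over_jacobson_unique over1 _; rewrite -st1.
  exact: overM (overB over1 (overM sg s'r)) tc.
have J2 : (g - g * gL) * r * c \in jacobson (endo X).
  do 2!apply: jacobsonMr; apply/quotJ_eq.
  by rewrite quotJ_piM gLz -compl_central zg.
have /jacobson_inv[w [w1 _]] := rpredD J1 J2.
exists (c * w); rewrite mulrA -[RHS]w1; congr (_ * w).
by rewrite opprD addrA subKr !mulrBl !mul1r !mulrA opprB addrA subrK.
Qed.

Variables (N L : lmodType S) (D : direct_sum M N L).
Hypothesis fE : corner_idem (dsum_inj2 D) (dsum_proj2 D) = f.

Local Notation i1 := (dsum_inj1 D).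
Local Notation i2 := (dsum_inj2 D).
Local Notation q1 := (dsum_proj1 D).
Local Notation q2 := (dsum_proj2 D).

Let iK1 : cancel i1 q1 := dsum_proj1_inj1 D.
Let iK2 : cancel i2 q2 := dsum_proj2_inj2 D.

Lemma corner_idem1E : corner_idem i1 q1 = 1 - f.
Proof. by rewrite -fE -(corner_idemD D) addrK. Qed.

(** The map lies over an element whose class has the form [(1 - z) x z], which is 0 by
    centrality. *)
Lemma hom12_jacobson (h : {linear N -> L}) : hom12_endo D h \in jacobson (endo M).
Proof.
rewrite -hom12_endo_corner corner_idem1E fE; have [g hg] := lift_p (hom12_endo D h).
apply: over_jacobson (overM (overM fgL hg) (overB over1 fgL)) _.
apply/quotJ_eq0; rewrite !quotJ_piM quotJ_piB quotJ_pi1 gLz subKr.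
by rewrite -mulrA -zC mulrA mulrBl mul1r zz subrr mul0r.
Qed.

Lemma hom21_jacobson (h : {linear L -> N}) : hom21_endo D h \in jacobson (endo M).
Proof.
rewrite -hom21_endo_corner corner_idem1E fE; have [g hg] := lift_p (hom21_endo D h).
apply: over_jacobson (overM (overM (overB over1 fgL) hg) fgL) _.
apply/quotJ_eq0; rewrite !quotJ_piM quotJ_piB quotJ_pi1 gLz subKr.
by rewrite -mulrA -compl_central mulrA mulrBr mulr1 zz subrr mul0r.
Qed.

Hypothesis regQ : von_neumann_regular (quotJ (endo X)).

Lemma quotJ_summand1_abelian :
    (forall e, e * e = e -> z * e = e -> forall x, e * x = x * e) ->
  abelian_regular (quotJ (endo N)).
Proof.
move=> idC; apply: strongly_regular_abelian => a; have [n <-] := quotJ_surj a.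
pose s := expand i1 q1 n; have [g sg] := lift_p s.
have zg : z * g%:J = g%:J.
  have s1 : (1 - f) * s = s by rewrite -corner_idem1E corner_expand.
  have := over_jacobson_unique (overM (overB over1 fgL) sg); rewrite s1 => J.
  have /quotJ_eq := J _ sg.
  by rewrite quotJ_piM quotJ_piB quotJ_pi1 gLz subKr.
(* A quasi-inverse in [z Q] need not descend; one that is a unit of [Q] does. *)
have [u [v [uv vu xux xxu]]] := central_regular_unit regQ zC idC zg.
have [t [h [th hu]]] := unit_descends uv vu.
exists (compress i1 q1 t)%:J; rewrite -!quotJ_piM; split; apply/quotJ_eq.
  rewrite -(compress_expandl iK1) -(compress_expandr iK1) -/s.
  rewrite -[n](expandK iK1) -/s -compressB; apply: compress_jacobson => //.
  apply: over_jacobson (overB (overM (overM sg th) sg) sg) _.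
  by apply/quotJ_eq; rewrite !quotJ_piM hu.
rewrite -(compress_expandl iK1) (expandM iK1) -/s.
rewrite -[n](expandK iK1) -/s -compressB; apply: compress_jacobson => //.
apply: over_jacobson (overB (overM (overM sg sg) th) sg) _.
by apply/quotJ_eq; rewrite !quotJ_piM hu.
Qed.

Lemma expand2_compl l g : over (expand i2 q2 l) g -> (1 - z) * g%:J = g%:J.
Proof. by apply: over_compl; rewrite -fE corner_expand. Qed.

Lemma expand2_jacobson l g :
  over (expand i2 q2 l) g -> (g \in jacobson (endo X)) = (l \in jacobson (endo L)).
Proof.
move=> lg; rewrite -(expand_jacobsonE iK2); apply/idP/idP => [|Jl].
  exact: over_jacobson.
exact: over_jacobson_reflect (expand2_compl lg) lg Jl.
Qed.

(** Lifting [expand l] along [p] identifies End(L) modulo its radical with the ideal [(1 - z) Q];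
    surjectivity holds because all of that ideal descends. *)
Lemma quotJ_summand2_self_injective :
    right_self_injective (quotJ (endo X)) ->
  von_neumann_regular (quotJ (endo L)) /\ right_self_injective (quotJ (endo L)).
Proof.
move=> injQ; have [lift liftE] := choice lift_p.
pose sigma (b : quotJ (endo L)) : quotJ (endo X) :=
  (lift (expand i2 q2 (repr b)))%:J.
have sigmaE l g : over (expand i2 q2 l) g -> sigma (l%:J) = g%:J.
  move=> lg; apply/quotJ_eq.
  have over_diff : over (expand i2 q2 (repr (l%:J) - l))
      (lift (expand i2 q2 (repr (l%:J))) - g).
    by rewrite expandB; apply: overB => //; exact: liftE.
  by rewrite (expand2_jacobson over_diff); apply/quotJ_eq; rewrite reprK.
have sigma1 : sigma 1 = 1 - z.
  by rewrite -quotJ_pi1 -gLz; apply: sigmaE; rewrite expand1 fE.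
apply: (central_corner_self_injective (sigma := sigma)) => //.
- move=> x y; have [l <-] := quotJ_surj x; have [m <-] := quotJ_surj y.
  have [g lg] := lift_p (expand i2 q2 l); have [h mh] := lift_p (expand i2 q2 m).
  rewrite -quotJ_piD (sigmaE _ _ lg) (sigmaE _ _ mh) -quotJ_piD; apply: sigmaE.
  by rewrite expandD; exact: overD.
- move=> x y; have [l <-] := quotJ_surj x; have [m <-] := quotJ_surj y.
  have [g lg] := lift_p (expand i2 q2 l); have [h mh] := lift_p (expand i2 q2 m).
  rewrite -quotJ_piM (sigmaE _ _ lg) (sigmaE _ _ mh) -quotJ_piM; apply: sigmaE.
  by rewrite expandM //; exact: overM.
- move=> x y; have [l <-] := quotJ_surj x; have [m <-] := quotJ_surj y.
  have [g lg] := lift_p (expand i2 q2 l); have [h mh] := lift_p (expand i2 q2 m).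
  rewrite (sigmaE _ _ lg) (sigmaE _ _ mh) => /quotJ_eq Jgh; apply/quotJ_eq.
  by rewrite -(@expand2_jacobson _ (g - h)) // expandB; exact: overB.
- by move=> x; rewrite sigma1 compl_central.
move=> x; have [r rx] := quotJ_surj x.
have [|s sr] := @descz (gL * r).
  by rewrite quotJ_piM mulrA gLz compl_idem.
exists (compress i2 q2 s)%:J; rewrite sigma1.
rewrite (sigmaE _ (gL * (gL * r) * gL)); last first.
  by rewrite expand_compress fE; exact: overM (overM fgL sr) fgL.
by rewrite !quotJ_piM gLz rx mulrA compl_idem -compl_central mulrA compl_idem.
Qed.

(** Lift [l] to End(X), correct it there to an idempotent, and descend. The result is idempotent in
    End(M) but only congruent to [expand l], so it is then moved into the corner. *)
Lemma summand2_idempotents_lift :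
  idempotents_lift_mod_J (endo X) -> idempotents_lift_mod_J (endo L).
Proof.
move=> liftX b; have [l <-] := quotJ_surj b.
rewrite -quotJ_piM => /quotJ_eq Jl; have [g lg] := lift_p (expand i2 q2 l).
have /quotJ_eq : g * g - g \in jacobson (endo X).
  rewrite (@expand2_jacobson (l * l - l)) // expandB expandM //.
  by apply: overB => //; exact: overM.
rewrite quotJ_piM => /liftX[e ee /quotJ_eq Jeg].
have [s se] := descends_coset lg Jeg.
have ss : s * s = s by have := overM se se; rewrite ee => sse; exact: over_inj sse se.
have [e' ee' Je'] := corner_idempotent_lift iK2 ss (over_jacobson (overB se lg) Jeg).
by exists e' => //; apply/quotJ_eq.
Qed.

(** The cover [Y] of [L] is a direct summand of [X]: [h] and [k0] lift the inclusion and the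
    projection, and minimality of [q] makes [k0 h] invertible. *)
Lemma summand2_endomorphism_coinvariant (cX : lmodType S -> Prop) :
    X_cover cX p -> has_X_cover cX L -> X_endomorphism_coinvariant cX L.
Proof.
move=> [[cXX preX] _] [Y [q covq]]; exists Y, q; split=> // y.
case: (covq) => -[cXY preY] minY.
have [h hE] := preX Y (i2 \o q : {linear Y -> M}) cXY.
have [k0 k0E] := preY X (q2 \o p : {linear X -> L}) cXX.
have [|w [wK Kw]] := @linear_inverse S _ _ (k0 \o h : {linear Y -> Y}).
  by apply: minY => x; rewrite /= [LHS]k0E /= [p _]hE; exact: iK2.
have qw x : q (w x) = q x.
  by rewrite -[x in RHS]Kw /= [RHS]k0E /= [p _]hE /= iK2.
have qk x : q (w (k0 x)) = q2 (p x) by rewrite qw [LHS]k0E.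
have kh x : w (k0 (h x)) = x by exact: wK.
(* [e] projects onto the copy of [Y] and [g] is [y] carried there, so [e g = g]. As [e] lies over
   [f], its class is [1 - z], and [g] descends. *)
pose e : endo X := (h \o w \o k0 : {linear X -> X}).
pose g : endo X := (h \o y \o w \o k0 : {linear X -> X}).
have fe : over f e.
  by move=> x; rewrite -fE corner_idemE -qk; symmetry; exact: hE.
have eg : e * g = g by apply: endoP => x; congr (h _); exact: kh.
have [|s sg] := @descz g.
  rewrite -{2}eg quotJ_piM; congr (_ * _); rewrite -gLz; apply/quotJ_eq.
  exact: over_jacobson_unique fgL fe.
exists (compress i2 q2 s) => x /=.
rewrite [LHS]compressE -[i2 _]hE /= sg -qk.
by congr (q _); rewrite !kh.
Qed.

End CentralIdempotent.
End AutomorphismDescent.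

(** * The decomposition of [M] *)

Lemma direct_summand2 (S : pzRingType) (M N L : lmodType S) :
  direct_sum M N L -> direct_summand L M.
Proof.
move=> D; exists N; constructor.
by case: D => i1 i2 q1 q2 ? ? ? ? iq; exists i2 i1 q2 q1 => // x; rewrite addrC.
Qed.

Theorem theorem4p9 (R : pzRingType) (cX : rmodType R -> Prop)
    (M X : rmodType R) (p : {linear X -> M}) :
  closed_under_iso cX ->
  X_cover cX p -> epimorphic p ->
  von_neumann_regular (quotJ (endo X)) ->
  right_self_injective (quotJ (endo X)) ->
  idempotents_lift_mod_J (endo X) ->
  X_automorphism_coinvariant cX M ->
  (forall N : rmodType R, direct_summand N M -> has_X_cover cX N) ->
  (exists (N L : rmodType R) (D : direct_sum M N L),
    [/\ square_free N,
        [/\ X_endomorphism_coinvariant cX L,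
            von_neumann_regular (quotJ (endo L)),
            right_self_injective (quotJ (endo L)) &
            idempotents_lift_mod_J (endo L)] &
        (forall f : {linear N -> L}, hom12_endo D f \in jacobson (endo M)) /\
        (forall f : {linear L -> N}, hom21_endo D f \in jacobson (endo M))]) /\
  (exists A B : pzRingType,
    [/\ abelian_regular A, von_neumann_regular B, right_self_injective B &
        ring_iso (quotJ (endo M)) (A * B)%type]).
Proof.
move=> _ covp epi_p regQ injQ liftX autM covN.
have [[cXX preX] minX] := covp.
have lift_p s : exists g, lies_over p s g.
  have [g gE] := preX X (endo_app s \o p : {linear X -> M}) cXX.
  by exists g => x; symmetry; exact: gE.
have min_p (h : endo X) : (forall x, p (endo_app h x) = p x) ->
    exists w, h * w = 1 /\ w * h = 1.
  move=> /minX/linear_inverse[w [hK wK]]; exists w.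
  by split; apply: endoP => x; [exact: wK | exact: hK].
have aut_p (g w : endo X) : g * w = 1 -> w * g = 1 -> exists s, lies_over p s g.
  move=> gw wg; have [|s sg] := cover_automorphism_descends covp autM (g := g).
    exists (endo_app w) => x.
      by rewrite -[LHS]/(endo_app (w * g) x) wg.
    by rewrite -[LHS]/(endo_app (g * w) x) gw.
  by exists s.
have [z [zz zC idC descU]] := abelian_unit_decomposition regQ injQ.
have descz (g : endo X) : (1 - z) * g%:J = g%:J -> exists s, lies_over p s g.
  (* [P] is the subring of classes with a descending representative. It contains the units, hence
     [(1 - z) Q], and then every representative descends. *)
  move=> zg; pose P (x : quotJ (endo X)) := exists s g, lies_over p s g /\ g%:J = x.
  have [|||t [h [th hg]]] := descU P _ _ _ g%:J.
  - by move=> _ _ [s [h [sh <-]]] [t [k [tk <-]]]; exists (s - t), (h - k);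
      rewrite quotJ_piB; split => //; exact: overB.
  - by move=> _ _ [s [h [sh <-]]] [t [k [tk <-]]]; exists (s * t), (h * k);
      rewrite quotJ_piM; split => //; exact: overM.
  - exact: unit_descends.
  apply: (descends_coset epi_p lift_p aut_p th); apply/quotJ_eq.
  by rewrite hg zg.
have zz1 := compl_idem zz.
have [gL gLL gLz] := liftX (1 - z) zz1.
have [|f fgL] := descz gL; first by rewrite gLz.
have ff : f * f = f.
  by have := overM fgL fgL; rewrite gLL => /(over_inj epi_p); exact.
have [N [L [D fE]]] := idempotent_direct_sum ff.
have covL := covN L (direct_summand2 D).
have abN := quotJ_summand1_abelian epi_p lift_p min_p aut_p zC gLz fgL fE regQ idC.
have [regL injL] :=
  quotJ_summand2_self_injective epi_p lift_p min_p aut_p zz zC gLz fgL descz fE regQ injQ.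
have J12 := hom12_jacobson epi_p lift_p aut_p zz zC gLz fgL fE.
have J21 := hom21_jacobson epi_p lift_p aut_p zz zC gLz fgL fE.
split; last first.
  exists (quotJ (endo N)), (quotJ (endo L)); split=> //.
  exact: quotJ_direct_sum J12 J21.
exists N, L, D; split=> //; first exact: abelian_regular_square_free.
split=> //.
  exact: (summand2_endomorphism_coinvariant min_p gLz fgL descz fE covp covL).
exact: (summand2_idempotents_lift epi_p lift_p min_p aut_p zz zC gLz fgL descz fE liftX).
Qed.
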